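(* Let $(P_1,\pi_1)$ and $(P_2,\pi_2)$ be regular Poisson manifolds that are Morita equivalent, via a complete full dual pair $P_1\stackrel{\rho_1}{\leftarrow}W\stackrel{\rho_2}{\rightarrow}P_2$ such that $\rho_1$ and $\rho_2$ have connected and simply connected fibers. Let $E:H^1_{\pi}(P_1)\to H^1_{\pi}(P_2)$ be the associated natural isomorphism of first Poisson cohomology spaces, and let $\pi_i^*:H^1_{\mathcal F}(P_i)\hookrightarrow H^1_\pi(P_i)$ be the natural injection of the first leafwise cohomology space of the symplectic foliation of $P_i$ ($i=1,2$). Then $$E\big(\pi_1^*(H^1_{\mathcal F}(P_1))\big)=\pi_2^*(H^1_{\mathcal F}(P_2)).$$ In particular, the first leafwise cohomology spaces $H^1_{\mathcal F}(P_1)$ and $H^1_{\mathcal F}(P_2)$ are isomorphic.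
   Context: For a Poisson manifold $(P,\pi)$ the bundle map $\pi:T^*P\to TP$ is defined by $\beta(\pi(\alpha))=\pi(\alpha,\beta)$, and $X_f=\pi(df)$ is the Hamiltonian vector field of $f$. $P$ is regular if this bundle map has constant rank; its symplectic foliation $\mathcal F$ is the regular foliation with $T\mathcal F=\pi(T^*P)$. The first Poisson cohomology space $H^1_\pi(P)$ is the space of vector fields $\xi$ with $L_\xi\pi=0$ modulo Hamiltonian vector fields. The first leafwise cohomology space $H^1_{\mathcal F}(P)$ is the first cohomology of the complex of smooth sections of $\wedge^rT^*\mathcal F$ (tangential forms) with the leafwise exterior derivative $d_{\mathcal F}$. For a regular Poisson manifold, the injection $\pi^*:H^1_{\mathcal F}(P)\to H^1_\pi(P)$ is $\pi^*[\alpha]=[\pi(\alpha)]$, where for a tangential 1-form $\alpha$ the vector field $\pi(\alpha)$ is determined by $\beta\mapsto\alpha(\pi(\beta))$, $\beta\in\Omega^1(P)$. A full dual pair $P_1\stackrel{\rho_1}{\leftarrow}W\stackrel{\rho_2}{\rightarrow}P_2$ consists of two Poisson manifolds $(P_1,\pi_1)$, $(P_2,\pi_2)$, a symplectic manifold $W$, and two (surjective) submersions $\rho_1:W\to P_1$, $\rho_2:W\to P_2$ such that $\rho_1$ is Poisson, $\rho_2$ is anti-Poisson, and the fibers of $\rho_1$ and $\rho_2$ are symplectically orthogonal to each other. A Poisson (or anti-Poisson) map is complete if the pull-back of every complete Hamiltonian flow under it is complete; the full dual pair is complete if $\rho_1$ and $\rho_2$ are complete. $P_1$ and $P_2$ are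 Morita equivalent if there is a complete full dual pair such that $\rho_1$ and $\rho_2$ both have connected and simply connected fibers. In that case there is (Ginzburg–Lu) a natural isomorphism $E:H^1_\pi(P_1)\to H^1_\pi(P_2)$ characterized by: $E([\xi_1])=[\xi_2]$ if and only if there exists $F\in C^\infty(W)$ such that $\xi_1=(\rho_1)_*X_F$ and $\xi_2=-(\rho_2)_*X_F$ (where $X_F$ is required to be projectable along $\rho_1$ and $\rho_2$); the existence of this isomorphism is taken as known. *)

(* Defs.v *)
From HB Require Import structures.
From mathcomp Require Import all_boot all_order all_algebra.
From mathcomp Require Import generic_quotient ring_quotient.
From mathcomp Require Import all_classical all_reals all_analysis.
From mathcomp Require Import ring lra.

Set Implicit Arguments.
Unset Strict Implicit.
Unset Printing Implicit Defensive.

Import Order.TTheory GRing.Theory Num.Theory.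
Import numFieldNormedType.Exports.
Local Open Scope classical_set_scope.
Local Open Scope ring_scope.
Local Open Scope quotient_scope.

Section LinearAlgebra.
Variable R : nzRingType.

Record subspace (V : lmodType R) := Subspace {
  subspace_mem :> V -> Prop;
  subspace0 : subspace_mem 0;
  subspaceP : forall a u v,
    subspace_mem u -> subspace_mem v -> subspace_mem (a *: u + v) }.

Definition in_subspace (V : lmodType R) (S : subspace V) : {pred V} :=
  fun v => `[< S v >].

Fact in_subspace_submod (V : lmodType R) (S : subspace V) :
  submod_closed (in_subspace S).
Proof.
split=> [|a u v]; first exact/asboolP/subspace0.
by move=> /asboolP Su /asboolP Sv; apply/asboolP/subspaceP.
Qed.

HB.instance Definition _ (V : lmodType R) (S : subspace V) :=
  GRing.isZmodClosed.Build V (in_subspace S)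
    (GRing.submod_closedB (in_subspace_submod S)).
HB.instance Definition _ (V : lmodType R) (S : subspace V) :=
  GRing.isSubmodClosed.Build R V (in_subspace S)
    (GRing.submod_closed_semi (in_subspace_submod S)).

(* The elements of a subspace, as a module. *)
Record elt (V : lmodType R) (S : subspace V) :=
  Elt { elt_val :> V; elt_in : elt_val \in in_subspace S }.

HB.instance Definition _ V S := [isSub for @elt_val V S].
HB.instance Definition _ V S := [Choice of @elt V S by <:].
HB.instance Definition _ V S := [SubChoice_isSubLmodule of @elt V S by <:].

Lemma eltP (V : lmodType R) (S : subspace V) (v : elt S) : S v.
Proof. by apply/asboolP; exact: elt_in. Qed.

Definition mk_elt (V : lmodType R) (S : subspace V) (v : V) (Sv : S v) :
    elt S :=
  Elt (introT (asboolP (S v)) Sv : v \in in_subspace S).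

Section Quotient.
Variables (V : lmodType R) (S : subspace V).
Local Notation Q := (Quotient.quot (in_subspace S)).
Definition lmod_quotient : Type := Q.
HB.instance Definition _ := GRing.Zmodule.copy lmod_quotient Q.

Definition qclass (v : V) : lmod_quotient := \pi_Q v.
Definition scaleq (a : R) (x : lmod_quotient) : lmod_quotient :=
  qclass (a *: repr (x : Q)).

Lemma qclassE u v : qclass u = qclass v <-> S (u - v).
Proof.
rewrite /qclass; split=> [/eqP|uv]; last apply/eqP; rewrite -Quotient.idealrBE.
  by move/asboolP.
exact/asboolP.
Qed.

Lemma qclassK (x : lmod_quotient) : qclass (repr (x : Q)) = x.
Proof. exact: reprK. Qed.

Fact qclassB : {morph qclass : u v / u - v}.
Proof. by move=> u v; rewrite /qclass raddfB. Qed.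
Fact qclassD : {morph qclass : u v / u + v}.
Proof. by move=> u v; rewrite /qclass raddfD. Qed.

Lemma qclass_scale a v : scaleq a (qclass v) = qclass (a *: v).
Proof.
apply/qclassE; rewrite -scalerBr -[_ *: _]addr0; apply: subspaceP.
  by apply/qclassE; rewrite qclassK.
exact: subspace0.
Qed.

Fact scaleqA a b x : scaleq a (scaleq b x) = scaleq (a * b) x.
Proof. by rewrite -[x]qclassK !qclass_scale scalerA. Qed.
Fact scale1q : left_id 1 scaleq.
Proof. by move=> x; rewrite -[x]qclassK !qclass_scale scale1r. Qed.
Fact scaleqDr : right_distributive scaleq +%R.
Proof.
move=> a x y; rewrite -[x]qclassK -[y]qclassK -qclassD !qclass_scale.
by rewrite scalerDr qclassD.
Qed.
Fact scaleqDl x : {morph scaleq^~ x : a b / a + b}.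
Proof.
by move=> a b; rewrite -[x]qclassK !qclass_scale scalerDl qclassD.
Qed.
HB.instance Definition _ := GRing.Zmodule_isLmodule.Build R lmod_quotient
  scaleqA scale1q scaleqDr scaleqDl.

Fact qclass_linear : linear qclass.
Proof. by move=> a u v; rewrite qclassD -qclass_scale. Qed.
HB.instance Definition _ := GRing.isLinear.Build R V lmod_quotient *:%R qclass
  qclass_linear.
End Quotient.

End LinearAlgebra.

Section LinearAlgebraField.
Variable R : realType.

Definition linear_form_subspace (V : lmodType R) : subspace (V -> R).
Proof.
refine (@Subspace R (V -> R) (fun phi => forall a u v,
  phi (a *: u + v) = a * phi u + phi v) _ _).
  by move=> a u v; rewrite -[RHS]/(a * 0 + 0) mulr0 addr0.
move=> a phi psi lphi lpsi b u v.
rewrite -[LHS]/(a * phi (b *: u + v) + psi (b *: u + v)) lphi lpsi.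
rewrite -[RHS]/(b * (a * phi u + psi u) + (a * phi v + psi v)); ring.
Defined.

Definition ldual (V : lmodType R) := elt (linear_form_subspace V).
Definition ldual_fun (V : lmodType R) (phi : ldual V) : V -> R := elt_val phi.
Coercion ldual_fun : ldual >-> Funclass.

(* Dependent functions, as a module; used for (not necessarily smooth) sections
   of a bundle with fibres V i. *)
Definition sect (I : Type) (V : I -> lmodType R) : Type := forall i, V i.

Section Sect.
Variables (I : Type) (V : I -> lmodType R).
HB.instance Definition _ := gen_eqMixin (sect V).
HB.instance Definition _ := gen_choiceMixin (sect V).
Local Notation ext := functional_extensionality_dep.
Fact sect_addA :
  associative (fun s t : sect V => (fun i => s i + t i) : sect V).
Proof. by move=> s t u; apply: ext => i; rewrite addrA. Qed.
Fact sect_addC :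
  commutative (fun s t : sect V => (fun i => s i + t i) : sect V).
Proof. by move=> s t; apply: ext => i; rewrite addrC. Qed.
Fact sect_add0 : left_id ((fun i => 0) : sect V)
  (fun s t : sect V => (fun i => s i + t i) : sect V).
Proof. by move=> s; apply: ext => i; rewrite add0r. Qed.
Fact sect_addN : left_inverse ((fun i => 0) : sect V)
  (fun s : sect V => (fun i => - s i) : sect V)
  (fun s t : sect V => (fun i => s i + t i) : sect V).
Proof. by move=> s; apply: ext => i; rewrite addNr. Qed.
HB.instance Definition _ := GRing.isZmodule.Build (sect V)
  sect_addA sect_addC sect_add0 sect_addN.
Definition sect_scale (a : R) (s : sect V) : sect V := fun i => a *: s i.
Fact sect_scaleA a b s : sect_scale a (sect_scale b s) = sect_scale (a * b) s.
Proof. by apply: ext => i; rewrite /sect_scale scalerA. Qed.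
Fact sect_scale1 : left_id 1 sect_scale.
Proof. by move=> s; apply: ext => i; rewrite /sect_scale scale1r. Qed.
Fact sect_scaleDr : right_distributive sect_scale +%R.
Proof. by move=> a s t; apply: ext => i; rewrite /sect_scale scalerDr. Qed.
Fact sect_scaleDl s : {morph sect_scale^~ s : a b / a + b}.
Proof. by move=> a b; apply: ext => i; rewrite /sect_scale scalerDl. Qed.
HB.instance Definition _ := GRing.Zmodule_isLmodule.Build R (sect V)
  sect_scaleA sect_scale1 sect_scaleDr sect_scaleDl.
End Sect.

Definition has_dim (V : lmodType R) (S : subspace V) (r : nat) :=
  exists b : 'I_r -> V,
    (forall v, S v <-> exists c : 'I_r -> R, v = \sum_i c i *: b i) /\
    (forall c : 'I_r -> R, \sum_i c i *: b i = 0 -> forall i, c i = 0).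
End LinearAlgebraField.

Section Smoothness.
Variables (R : realType) (n : nat).
Implicit Types (U : set 'rV[R]_n) (f g : 'rV[R]_n -> R).

Fixpoint Ck (k : nat) U f : Prop :=
  match k with
  | 0 => forall x, U x -> {for x, continuous f}
  | k'.+1 => exists df : 'rV[R]_n -> 'rV[R]_n -> R,
      (forall x, U x -> is_diff x f (df x)) /\ (forall v, Ck k' U (df^~ v))
  end.

(* On an open set U the existentially quantified df is the Frechet derivative, so
   this is the usual C^k class; it is only used for open U. *)
Definition Csmooth U f := forall k, Ck k U f.

Lemma Ck_down k U f : Ck k.+1 U f -> Ck k U f.
Proof.
elim: k f => [|k IH] f [df [fdf Cdf]] /=.
  by move=> x Ux; apply: differentiable_continuous; case: (fdf x Ux).
by exists df; split=> // v; apply: IH; exact: Cdf.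
Qed.

Lemma Ck_cst k U a : Ck k U (fun=> a).
Proof.
elim: k a => [|k IH] a /=; first by move=> x _; apply: cst_continuous.
exists (fun _ _ => 0); split=> [x _|v]; last exact: IH.
exact: is_diff_cst.
Qed.

Lemma CkD k U f g : Ck k U f -> Ck k U g -> Ck k U (fun x => f x + g x).
Proof.
elim: k f g => [|k IH] f g /=.
  by move=> cf cg x Ux; apply: continuousD; [exact: cf|exact: cg].
move=> [df [fdf Cdf]] [dg [gdg Cdg]].
exists (fun x v => df x v + dg x v); split=> [x Ux|v]; last exact: IH.
by have := fdf x Ux; have := gdg x Ux => ? ?; exact: is_diffD.
Qed.

Lemma CkM k U f g : Ck k U f -> Ck k U g -> Ck k U (fun x => f x * g x).
Proof.
elim: k f g => [|k IH] f g.
  by move=> cf cg x Ux; apply: continuousM; [exact: cf|exact: cg].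
move=> Cf Cg; have [Cf' Cg'] := (Ck_down Cf, Ck_down Cg).
case: Cf Cg => [df [fdf Cdf]] [dg [gdg Cdg]].
exists (fun x v => f x * dg x v + g x * df x v); split=> [x Ux|v].
  by have := fdf x Ux; have := gdg x Ux => ? ?; exact: is_diffM.
by apply: CkD; apply: IH => //; [exact: Cdg|exact: Cdf].
Qed.
End Smoothness.

Section Manifold.
Variable R : realType.

(* cinv is only meaningful on the open set cmap @` cdom. *)
Record chart (T : topologicalType) (n : nat) := Chart {
  cdom : set T;
  cmap :> T -> 'rV[R]_n;
  cinv : 'rV[R]_n -> T;
  cdom_open : open cdom;
  cimg_open : open (cmap @` cdom);
  cmapK : forall p, cdom p -> cinv (cmap p) = p;
  cmap_continuous : forall p, cdom p -> {for p, continuous cmap};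
  cinv_continuous : forall x, (cmap @` cdom) x -> {for x, continuous cinv} }.

(* Hausdorff, second countable, of constant dimension mdim (possibly 0).  The
   atlas need not be maximal. *)
Record manifold := Manifold {
  mspace :> topologicalType;
  mdim : nat;
  atlas : set (chart mspace mdim);
  mhausdorff : hausdorff_space mspace;
  msecond_countable : @second_countable mspace;
  atlas_cover : forall p, exists2 c, atlas c & cdom c p;
  atlas_compat : forall c d, atlas c -> atlas d -> forall j,
    Csmooth (c @` (cdom c `&` cdom d)) (fun x => d (cinv c x) ord0 j) }.

Definition smooth_on (M : manifold) (U : set M) (f : M -> R) :=
  forall c, atlas c -> Csmooth (c @` (cdom c `&` U)) (f \o cinv c).

Definition smooth (M : manifold) (f : M -> R) := smooth_on setT f.

Lemma smooth_cst (M : manifold) a : smooth ((fun=> a) : M -> R).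
Proof. by move=> c _ k; exact: Ck_cst. Qed.

Lemma smoothD (M : manifold) (f g : M -> R) :
  smooth f -> smooth g -> smooth (fun p => f p + g p).
Proof. by move=> sf sg c Ac k; apply: CkD; [exact: sf|exact: sg]. Qed.

Lemma smoothM (M : manifold) (f g : M -> R) :
  smooth f -> smooth g -> smooth (fun p => f p * g p).
Proof. by move=> sf sg c Ac k; apply: CkM; [exact: sf|exact: sg]. Qed.

Lemma smoothZ (M : manifold) a (f : M -> R) :
  smooth f -> smooth (fun p => a * f p).
Proof. by apply: smoothM; exact: smooth_cst. Qed.

Lemma smoothB (M : manifold) (f g : M -> R) :
  smooth f -> smooth g -> smooth (fun p => f p - g p).
Proof.
move=> sf sg; have := smoothD sf (smoothZ (-1) sg).
by under eq_fun do rewrite mulN1r.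
Qed.

Definition smooth_pred (M : manifold) : {pred M -> R} :=
  fun f => `[< smooth f >].

Fact smooth_pred_subring M : subring_closed (@smooth_pred M).
Proof.
split=> [|f g|f g]; first by apply/asboolP; exact: smooth_cst.
  by move=> /asboolP sf /asboolP sg; apply/asboolP; exact: smoothB.
by move=> /asboolP sf /asboolP sg; apply/asboolP; exact: smoothM.
Qed.
Fact smooth_pred_submod M : submod_closed (@smooth_pred M).
Proof.
split=> [|a f g]; first by apply/asboolP; exact: smooth_cst.
move=> /asboolP sf /asboolP sg; apply/asboolP.
by apply: smoothD => //; exact: smoothZ.
Qed.
HB.instance Definition _ (M : manifold) := GRing.isSubringClosed.Build (M -> R)
  (@smooth_pred M) (smooth_pred_subring M).
HB.instance Definition _ (M : manifold) := GRing.isSubmodClosed.Build R (M -> R)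
  (@smooth_pred M) (GRing.submod_closed_semi (smooth_pred_submod M)).

(* The algebra of smooth functions on M. *)
Record cinf (M : manifold) := Cinf {
  cinf_fun : M -> R; cinf_in : cinf_fun \in @smooth_pred M }.
HB.instance Definition _ (M : manifold) := [isSub for @cinf_fun M].
HB.instance Definition _ (M : manifold) := [Choice of cinf M by <:].
HB.instance Definition _ (M : manifold) :=
  GRing.SubChoice_isSubComPzRing.Build (M -> R) (@smooth_pred M) (cinf M)
    (smooth_pred_subring M).
HB.instance Definition _ (M : manifold) :=
  [SubZmodule_isSubLmodule of cinf M by <:].
Coercion cinf_fun : cinf >-> Funclass.

Lemma cinfP (M : manifold) (f : cinf M) : smooth f.
Proof. by apply/asboolP; exact: cinf_in. Qed.
Definition mk_cinf (M : manifold) (f : M -> R) (sf : smooth f) : cinf M :=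
  Cinf (introT (asboolP (smooth f)) sf : f \in @smooth_pred M).

End Manifold.

Section Tangent.
Variables (R : realType) (M : manifold R).

(* Tangent vectors at p are the derivations at p of the algebra of smooth
   functions. *)
Definition tangent_subspace (p : M) : subspace (cinf M -> R).
Proof.
refine (@Subspace R (cinf M -> R) (fun v =>
  (forall a f g, v (a *: f + g) = a * v f + v g) /\
  (forall f g, v (f * g) = f p * v g + g p * v f)) _ _).
  split=> [a f g|f g].
    by rewrite -[RHS]/(a * 0 + 0) mulr0 addr0.
  by rewrite -[RHS]/(f p * 0 + g p * 0) !mulr0 addr0.
move=> a u v [uL uD] [vL vD]; split=> [b f g|f g].
  rewrite -[LHS]/(a * u (b *: f + g) + v (b *: f + g)) uL vL.
  rewrite -[RHS]/(b * (a * u f + v f) + (a * u g + v g)); ring.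
rewrite -[LHS]/(a * u (f * g) + v (f * g)) uD vD.
rewrite -[RHS]/(f p * (a * u g + v g) + g p * (a * u f + v f)); ring.
Defined.

Definition tangent (p : M) := elt (tangent_subspace p).
Definition tangent_fun (p : M) (v : tangent p) : cinf M -> R := elt_val v.
Coercion tangent_fun : tangent >-> Funclass.

Lemma tangent_linear p (v : tangent p) a f g : v (a *: f + g) = a * v f + v g.
Proof. exact: (eltP v).1. Qed.
Lemma tangent_leibniz p (v : tangent p) f g : v (f * g) = f p * v g + g p * v f.
Proof. exact: (eltP v).2. Qed.
Lemma tangent0 p (v : tangent p) : v 0 = 0.
Proof.
by have := tangent_linear v 1 0 0; rewrite scaler0 addr0; lra.
Qed.
Lemma tangentB p (v : tangent p) f g : v (f - g) = v f - v g.
Proof.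
by rewrite addrC -scaleN1r tangent_linear mulN1r addrC.
Qed.

Definition cotangent (p : M) := ldual (tangent p).

Definition cotangent_fun (p : M) (alpha : cotangent p) : tangent p -> R :=
  ldual_fun alpha.
Coercion cotangent_fun : cotangent >-> Funclass.

Fact cdiff_proof (f : cinf M) (p : M) :
  linear_form_subspace (tangent p) (fun v : tangent p => v f).
Proof. by []. Qed.
Definition cdiff (f : cinf M) (p : M) : cotangent p :=
  mk_elt (@cdiff_proof f p).

(* Smooth sections of the tangent bundle. *)
Definition vfield_subspace : subspace (sect (fun p : M => tangent p)).
Proof.
refine (@Subspace R (sect (fun p : M => tangent p)) (fun X =>
  forall f : cinf M, smooth (fun p => (X p : tangent p) f)) _ _).
  by move=> f; exact: smooth_cst.
move=> a X Y sX sY f.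
by apply: smoothD; [apply: smoothZ; exact: sX|exact: sY].
Defined.

Definition vfield := elt vfield_subspace.
Definition vfield_fun (X : vfield) : forall p, tangent p := elt_val X.
Coercion vfield_fun : vfield >-> Funclass.

Definition vf_app (X : vfield) (f : cinf M) : cinf M := mk_cinf (eltP X f).

Fact lie_subproof (X Y : vfield) (p : M) :
  tangent_subspace p (fun f => X p (vf_app Y f) - Y p (vf_app X f)).
Proof.
have appD Z a f g : vf_app Z (a *: f + g) = a *: vf_app Z f + vf_app Z g.
  by apply/val_inj/funext => q /=; rewrite tangent_linear.
have appM Z f g : vf_app Z (f * g) = f * vf_app Z g + g * vf_app Z f.
  by apply/val_inj/funext => q /=; rewrite tangent_leibniz.
have tD (v : tangent p) f g : v (f + g) = v f + v g.
  by rewrite -[f]scale1r tangent_linear mul1r scale1r.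
split=> [a f g|f g]; first by rewrite !appD !tangent_linear; ring.
rewrite !appM !tD !tangent_leibniz /=; ring.
Qed.

Fact lie_smooth (X Y : vfield) :
  vfield_subspace (fun p => mk_elt (lie_subproof X Y p)).
Proof.
move=> f; apply: smoothB.
  exact: (eltP X (vf_app Y f)).
exact: (eltP Y (vf_app X f)).
Qed.

Definition lie (X Y : vfield) : vfield := mk_elt (lie_smooth X Y).

(* X need not be known to be smooth.  The velocity of gamma at t is the derivation
   f |-> (f o gamma)'(t). *)
Definition complete_vf (X : forall p : M, tangent p) :=
  forall p, exists gamma : R -> M,
    [/\ continuous gamma, gamma 0 = p &
        forall (t : R) (f : cinf M),
          is_derive t (1 : R) (fun s : R => f (gamma s)) (X (gamma t) f)].

Record two_form := TwoForm {
  form2_fun :> forall p : M, tangent p -> tangent p -> R;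
  form2_linear : forall p a (u v w : tangent p),
    form2_fun (a *: u + v) w = a * form2_fun u w + form2_fun v w;
  form2_anti : forall p (u v : tangent p), form2_fun u v = - form2_fun v u;
  form2_smooth : forall X Y : vfield, smooth (fun p => form2_fun (X p) (Y p)) }.

Definition form2_app (omega : two_form) (X Y : vfield) : cinf M :=
  mk_cinf (form2_smooth omega X Y).

(* The exterior derivative by the Cartan formula. *)
Definition ext_deriv2 (omega : two_form) (X Y Z : vfield) (p : M) : R :=
  X p (form2_app omega Y Z) - Y p (form2_app omega X Z)
  + Z p (form2_app omega X Y)
  - omega p (lie X Y p) (Z p) + omega p (lie X Z p) (Y p)
  - omega p (lie Y Z p) (X p).

Definition closed2 (omega : two_form) :=
  forall X Y Z p, ext_deriv2 omega X Y Z p = 0.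

(* u |-> omega(-, u) is an isomorphism from T_p onto its dual. *)
Definition nondegenerate (omega : two_form) :=
  forall p (alpha : cotangent p),
    exists! u : tangent p, forall v, omega p v u = alpha v.

(* The differentials df span the cotangent spaces, so smoothness can be tested on
   them. *)
Record bivector := Bivector {
  biv_fun :> forall p : M, cotangent p -> cotangent p -> R;
  biv_linear : forall p a (alpha beta gamma : cotangent p),
    biv_fun (a *: alpha + beta) gamma
      = a * biv_fun alpha gamma + biv_fun beta gamma;
  biv_anti : forall p (alpha beta : cotangent p),
    biv_fun alpha beta = - biv_fun beta alpha;
  biv_smooth : forall f g : cinf M,
    smooth (fun p => biv_fun (cdiff f p) (cdiff g p)) }.

Definition bracket (pi : bivector) (f g : cinf M) : cinf M :=
  mk_cinf (biv_smooth pi f g).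

End Tangent.

Section Maps.
Variables (R : realType) (M N : manifold R).

(* A continuous map which pulls back locally defined smooth functions to smooth
   functions. *)
Record smap := Smap {
  smap_fun :> M -> N;
  smap_continuous : continuous smap_fun;
  smap_smooth : forall (V : set N) (g : N -> R), open V ->
    smooth_on V g -> smooth_on (smap_fun @^-1` V) (g \o smap_fun) }.

Fact pullback_smooth (rho : smap) (g : cinf N) : smooth (g \o rho).
Proof. exact: (@smap_smooth rho setT g openT (cinfP g)). Qed.
Definition pullback (rho : smap) (g : cinf N) : cinf M :=
  mk_cinf (pullback_smooth rho g).

Fact tmap_subproof (rho : smap) (p : M) (v : tangent p) :
  tangent_subspace (rho p) (fun g => v (pullback rho g)).
Proof.
have pD a f g : pullback rho (a *: f + g)
    = a *: pullback rho f + pullback rho g.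
  exact/val_inj.
have pM f g : pullback rho (f * g) = pullback rho f * pullback rho g.
  exact/val_inj.
split=> [a f g|f g]; first by rewrite pD tangent_linear.
by rewrite pM tangent_leibniz.
Qed.
Definition tmap (rho : smap) (p : M) (v : tangent p) : tangent (rho p) :=
  mk_elt (tmap_subproof rho v).

Definition submersion (rho : smap) :=
  forall p (w : tangent (rho p)), exists v : tangent p, tmap rho v = w.

End Maps.

Section Poisson.
Variable R : realType.

(* The Jacobi identity of {f, g} = pi(df, dg) is the condition [pi, pi] = 0. *)
Record poisson_manifold := PoissonManifold {
  poisson_space :> manifold R;
  poisson_biv : bivector poisson_space;
  jacobi : forall f g h p,
    bracket poisson_biv f (bracket poisson_biv g h) p
    + bracket poisson_biv g (bracket poisson_biv h f) p
    + bracket poisson_biv h (bracket poisson_biv f g) p = 0 }.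

Variable P : poisson_manifold.
Local Notation pi := (poisson_biv P).
Implicit Types (p : P) (f g h : cinf P).

Lemma cdiff_linear a f g p : cdiff (a *: f + g) p = a *: cdiff f p + cdiff g p.
Proof.
apply/val_inj/funext => v; exact: (tangent_linear (v : tangent p) a f g).
Qed.
Lemma cdiff_leibniz f g p :
  cdiff (f * g) p = f p *: cdiff g p + g p *: cdiff f p.
Proof.
apply/val_inj/funext => v; exact: (tangent_leibniz (v : tangent p) f g).
Qed.

Lemma biv_linearr p a (alpha beta gamma : cotangent p) :
  pi p gamma (a *: alpha + beta) = a * pi p gamma alpha + pi p gamma beta.
Proof.
by rewrite biv_anti biv_linear opprD -mulrN -!(biv_anti _ gamma).
Qed.

Lemma biv0r p (gamma : cotangent p) : pi p gamma 0 = 0.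
Proof.
by have := biv_linearr 1 0 0 gamma; rewrite scaler0 addr0; lra.
Qed.
Lemma bivZr p a (alpha gamma : cotangent p) :
  pi p gamma (a *: alpha) = a * pi p gamma alpha.
Proof. by rewrite -[a *: _]addr0 biv_linearr biv0r addr0. Qed.

Fact sharp_subproof p (alpha : cotangent p) :
  tangent_subspace p (fun f => pi p alpha (cdiff f p)).
Proof.
split=> [a f g|f g]; first by rewrite cdiff_linear biv_linearr.
by rewrite cdiff_leibniz biv_linearr bivZr.
Qed.
(* The bundle map pi : T*P -> TP, beta(pi(alpha)) = pi(alpha, beta), written on
   beta = df. *)
Definition sharp p (alpha : cotangent p) : tangent p :=
  mk_elt (sharp_subproof alpha).

Definition ham f p : tangent p := sharp (cdiff f p).

Lemma sharp_linear p a (alpha beta : cotangent p) :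
  sharp (a *: alpha + beta) = a *: sharp alpha + sharp beta.
Proof. by apply/val_inj/funext => f; exact: biv_linear. Qed.

(* The fibre of TF = pi(T*P). *)
Definition leaf_subspace p : subspace (tangent p).
Proof.
refine (@Subspace R (tangent p)
  (fun v => exists alpha, v = @sharp p alpha) _ _).
  exists 0; apply/val_inj/funext => f.
  by rewrite -[RHS]/(pi p 0 (cdiff f p)) biv_anti biv0r oppr0.
by move=> a u v [alpha ->] [beta ->]; exists (a *: alpha + beta);
  rewrite sharp_linear.
Defined.

Definition regular_poisson := exists r, forall p, has_dim (leaf_subspace p) r.

Definition leaf_tangent p := elt (leaf_subspace p).
Definition leaf_cotangent p := ldual (leaf_tangent p).

Definition leaf_cotangent_fun p (alpha : leaf_cotangent p) :
  leaf_tangent p -> R := ldual_fun alpha.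
Coercion leaf_cotangent_fun : leaf_cotangent >-> Funclass.

Definition leaf_vfield_subspace : subspace (vfield P).
Proof.
refine (@Subspace R (vfield P)
  (fun X => forall p, leaf_subspace p ((X : vfield P) p)) _ _).
  by move=> p; exact: subspace0.
by move=> a X Y tX tY p; exact: (subspaceP a (tX p) (tY p)).
Defined.
Definition leaf_vfield := elt leaf_vfield_subspace.
Definition leaf_vfield_val (X : leaf_vfield) : vfield P := elt_val X.
Coercion leaf_vfield_val : leaf_vfield >-> vfield.
Definition leaf_at (X : leaf_vfield) p : leaf_tangent p := mk_elt (eltP X p).

(* Tangential 1-forms: smooth sections of T*F. *)
Definition leaf_form_subspace : subspace (sect (fun p : P => leaf_cotangent p)).
Proof.
refine (@Subspace R (sect (fun p : P => leaf_cotangent p)) (fun alpha =>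
  forall X : leaf_vfield,
    smooth (fun p => (alpha p : leaf_cotangent p) (leaf_at X p))) _ _).
  by move=> X; exact: smooth_cst.
move=> a alpha beta sa sb X.
by apply: smoothD; [apply: smoothZ; exact: sa|exact: sb].
Defined.
Definition leaf_form := elt leaf_form_subspace.
Definition leaf_form_fun (alpha : leaf_form) : forall p, leaf_cotangent p :=
  elt_val alpha.
Coercion leaf_form_fun : leaf_form >-> Funclass.

Definition leaf_form_app (alpha : leaf_form) (X : leaf_vfield) : cinf P :=
  mk_cinf (eltP alpha X).

(* d_F alpha (X, Y) = X(alpha(Y)) - Y(alpha(X)) - alpha([X, Y]) = 0 for all X, Y
   tangent to F.  The quantification over Z only serves to view [X, Y], which is
   again tangent to F when F is a foliation, as a section of TF. *)
Definition closed_form_subspace : subspace leaf_form.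
Proof.
refine (@Subspace R leaf_form (fun alpha =>
  forall X Y Z : leaf_vfield, Z = lie X Y :> vfield P -> forall p,
    X p (leaf_form_app alpha Y) - Y p (leaf_form_app alpha X)
    - (alpha : leaf_form) p (leaf_at Z p) = 0) _ _).
  move=> X Y Z _ p.
  have E V : leaf_form_app 0 V = 0 by exact/val_inj.
  by rewrite !E !tangent0 subr0 -[X in - X]/(0 : R) subr0.
move=> a alpha beta ca cb X Y Z ZXY p.
have E V : leaf_form_app (a *: alpha + beta) V
    = a *: leaf_form_app alpha V + leaf_form_app beta V by exact/val_inj.
rewrite !E !tangent_linear.
rewrite -[X in _ - X]/(a * (alpha : leaf_form) p (leaf_at Z p)
  + (beta : leaf_form) p (leaf_at Z p)).
have := ca X Y Z ZXY p; have := cb X Y Z ZXY p; set u := _ p _; nra.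
Defined.
Definition closed_form := elt closed_form_subspace.
Definition closed_form_val (alpha : closed_form) : leaf_form := elt_val alpha.
Coercion closed_form_val : closed_form >-> leaf_form.

(* alpha = d_F f. *)
Definition exact_form_subspace : subspace closed_form.
Proof.
refine (@Subspace R closed_form (fun alpha => exists f : cinf P,
  forall p (v : leaf_tangent p),
    (alpha : closed_form) p v = (elt_val v : tangent p) f) _ _).
  by exists 0 => p v; rewrite tangent0.
move=> a alpha beta [f fE] [g gE]; exists (a *: f + g) => p v.
by rewrite tangent_linear -fE -gE.
Defined.

Definition leaf_H1 := lmod_quotient exact_form_subspace.

(* (L_xi pi)(df, dg), using L_xi df = d(xi f). *)
Definition lie_bivector (xi : vfield P) f g p : R :=
  xi p (bracket pi f g) - pi p (cdiff (vf_app xi f) p) (cdiff g p)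
  - pi p (cdiff f p) (cdiff (vf_app xi g) p).

Fact vf_app_linear a (X Y : vfield P) f :
  vf_app (a *: X + Y) f = a *: vf_app X f + vf_app Y f.
Proof. exact/val_inj. Qed.

Definition poisson_vfield_subspace : subspace (vfield P).
Proof.
refine (@Subspace R (vfield P)
  (fun xi => forall f g p, lie_bivector xi f g p = 0) _ _).
  move=> f g p; rewrite /lie_bivector.
  have E h : vf_app 0 h = 0 :> cinf P by exact/val_inj.
  have E0 : cdiff 0 p = 0.
    by apply/val_inj/funext => v; exact: (tangent0 (v : tangent p)).
  rewrite !E E0 biv0r biv_anti biv0r -[X in X - _ - _]/(0 : R); ring.
move=> a; rewrite -[GRing.Lmodule.sort _]/(vfield P) => X Y PX PY f g p.
rewrite /lie_bivector !vf_app_linear !cdiff_linear.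
rewrite biv_linear biv_linearr.
rewrite -[X in X - _ - _]/(a * X p (bracket pi f g) + Y p (bracket pi f g)).
have := PX f g p; have := PY f g p; rewrite /lie_bivector.
set x1 := pi _ _ _; set x2 := pi _ _ _; set x3 := pi _ _ _; set x4 := pi _ _ _.
set y1 := Y _ _; set y2 := X _ _ => h1 h2.
have -> : a * y2 + y1 - (a * x3 + x1) - (a * x4 + x2)
  = a * (y2 - x3 - x4) + (y1 - x1 - x2) by ring.
by rewrite h1 h2 mulr0 addr0.
Defined.

Definition poisson_vfield := elt poisson_vfield_subspace.
Definition poisson_vfield_val (xi : poisson_vfield) : vfield P := elt_val xi.
Coercion poisson_vfield_val : poisson_vfield >-> vfield.

Lemma ham_linear a f g p : ham (a *: f + g) p = a *: ham f p + ham g p.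
Proof. by rewrite /ham cdiff_linear sharp_linear. Qed.

Definition hamiltonian_subspace : subspace poisson_vfield.
Proof.
refine (@Subspace R poisson_vfield (fun xi => exists f : cinf P,
  forall p, (xi : poisson_vfield) p = ham f p) _ _).
  exists 0 => p; apply/val_inj/funext => g.
  have E0 : cdiff 0 p = 0.
    by apply/val_inj/funext => v; exact: (tangent0 (v : tangent p)).
  by rewrite /= E0 biv_anti biv0r oppr0.
move=> a X Y [f fE] [g gE]; exists (a *: f + g) => p.
by rewrite ham_linear -fE -gE.
Defined.

Definition poisson_H1 := lmod_quotient hamiltonian_subspace.

Fact ham_leaf f p : leaf_subspace p (ham f p).
Proof. by exists (cdiff f p). Qed.
Definition leaf_ham f p : leaf_tangent p := mk_elt (ham_leaf f p).

Fact ham_smooth f : vfield_subspace P (ham f).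
Proof. by move=> g; exact: (cinfP (bracket pi f g)). Qed.
Definition ham_vfield f : vfield P := mk_elt (ham_smooth f).
Definition ham_leaf_vfield f : leaf_vfield :=
  mk_elt ((fun p => ham_leaf f p) : leaf_vfield_subspace (ham_vfield f)).

Lemma leaf_cotangent_linear p (alpha : leaf_cotangent p) a u v :
  alpha (a *: u + v) = a * alpha u + alpha v.
Proof. exact: (eltP alpha a u v). Qed.

(* For a tangential 1-form alpha, the vector field pi(alpha) given by
   beta(pi(alpha)) = alpha(pi(beta)), written on beta = df. *)
Fact sharp_form_subproof (alpha : leaf_form) p :
  tangent_subspace p (fun f => alpha p (leaf_ham f p)).
Proof.
have Z a u : alpha p (a *: u) = a * alpha p u.
  have h0 : alpha p 0 = 0.
    have := leaf_cotangent_linear (alpha p) 1 0 0.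
    by rewrite scaler0 addr0; lra.
  by rewrite -[_ *: _]addr0 leaf_cotangent_linear h0 addr0.
split=> [a f g|f g].
  rewrite -[RHS]leaf_cotangent_linear; congr (alpha p _); apply/val_inj.
  exact: ham_linear.
rewrite -[g p * _]Z -[RHS]leaf_cotangent_linear.
congr (alpha p _); apply/val_inj => /=.
rewrite /ham cdiff_leibniz sharp_linear; congr (_ + _).
by rewrite -[_ *: _]addr0 sharp_linear; apply/val_inj/funext => h;
  rewrite /= -[RHS]addr0; congr (_ + _); rewrite biv_anti biv0r oppr0.
Qed.
Definition sharp_form_at (alpha : leaf_form) p : tangent p :=
  mk_elt (sharp_form_subproof alpha p).

Fact leaf_at_ham f p : leaf_at (ham_leaf_vfield f) p = leaf_ham f p.
Proof. exact/val_inj. Qed.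

Fact sharp_form_smooth (alpha : leaf_form) :
  vfield_subspace P (sharp_form_at alpha).
Proof.
move=> f; have := eltP alpha (ham_leaf_vfield f).
by under eq_fun do rewrite leaf_at_ham.
Qed.
Definition sharp_form_vfield (alpha : leaf_form) : vfield P :=
  mk_elt (sharp_form_smooth alpha).

Fact leaf_form_app_ham (alpha : leaf_form) f :
  leaf_form_app alpha (ham_leaf_vfield f) = vf_app (sharp_form_vfield alpha) f.
Proof. by apply/val_inj/funext => p /=; rewrite leaf_at_ham. Qed.

Fact vf_app_ham f g : vf_app (ham_vfield f) g = bracket pi f g.
Proof. exact/val_inj. Qed.

Fact lie_ham f g :
  ham_vfield (bracket pi f g) = lie (ham_vfield f) (ham_vfield g).
Proof.
apply/val_inj/functional_extensionality_dep => p; apply/val_inj/funext => h.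
rewrite -[LHS]/(bracket pi (bracket pi f g) h p).
rewrite -[RHS]/(ham f p (vf_app (ham_vfield g) h)
  - ham g p (vf_app (ham_vfield f) h)) !vf_app_ham.
rewrite -[X in _ = X - _]/(bracket pi f (bracket pi g h) p).
rewrite -[X in _ = _ - X]/(bracket pi g (bracket pi f h) p).
have anti u v q : bracket pi u v q = - bracket pi v u q by exact: biv_anti.
have antif : bracket pi h f = - bracket pi f h by exact/val_inj/funext/anti.
have := jacobi f g h p; rewrite antif (anti h).
rewrite -[X in _ + X + _]/(ham g p (- bracket pi f h)) -sub0r tangentB tangent0.
rewrite -[X in _ + (0 - X) + _]/(bracket pi g (bracket pi f h) p); lra.
Qed.

Fact sharp_form_poisson (alpha : closed_form) :
  poisson_vfield_subspace (sharp_form_vfield alpha).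
Proof.
move=> f g p.
have := eltP alpha (ham_leaf_vfield f) (ham_leaf_vfield g)
  (ham_leaf_vfield (bracket pi f g)) (lie_ham f g) p.
rewrite !leaf_form_app_ham leaf_at_ham /lie_bivector.
rewrite -[X in X - _ - _ = _ -> _]/(pi p (cdiff f p) _).
rewrite -[X in _ - X - _ = _ -> _]/(pi p (cdiff g p) _).
rewrite -[X in _ - X = _ -> _]/(sharp_form_vfield alpha p (bracket pi f g)).
rewrite (biv_anti _ (cdiff g p)); lra.
Qed.

Definition sharp_form (alpha : closed_form) : poisson_vfield :=
  mk_elt (sharp_form_poisson alpha).

Fact sharp_form_linear : linear sharp_form.
Proof.
move=> a alpha beta; apply/val_inj/val_inj/functional_extensionality_dep => p.
exact/val_inj.
Qed.
HB.instance Definition _ := GRing.isLinear.Build R closed_form poisson_vfield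
  *:%R sharp_form sharp_form_linear.

Fact sharp_form_exact (alpha : closed_form) :
  exact_form_subspace alpha -> hamiltonian_subspace (sharp_form alpha).
Proof.
move=> [f fE]; exists (- f) => p; apply/val_inj/funext => g.
rewrite -[LHS]/(alpha p (leaf_ham g p)) fE.
rewrite -[RHS]/(pi p (cdiff (- f) p) (cdiff g p)) biv_anti.
rewrite -[LHS]/(ham g p f) -[RHS]/(- ham g p (- f)).
by rewrite -[- f]sub0r tangentB tangent0 sub0r opprK.
Qed.

(* pi^* : H^1_F -> H^1_pi; see sharp_H1E for its value on a class. *)
Definition sharp_H1 (c : leaf_H1) : poisson_H1 :=
  qclass hamiltonian_subspace (sharp_form (repr c)).

Lemma sharp_H1E (alpha : closed_form) :
  sharp_H1 (qclass exact_form_subspace alpha)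
    = qclass hamiltonian_subspace (sharp_form alpha).
Proof.
apply/qclassE; rewrite -linearB; apply: sharp_form_exact.
by apply/qclassE; rewrite qclassK.
Qed.

Fact sharp_H1_linear : linear sharp_H1.
Proof.
move=> a x y; rewrite -[x]qclassK -[y]qclassK -linearP !sharp_H1E.
by rewrite !linearP.
Qed.
HB.instance Definition _ := GRing.isLinear.Build R leaf_H1 poisson_H1 *:%R
  sharp_H1 sharp_H1_linear.

End Poisson.

Section Morita.
Variable R : realType.

Record symplectic_manifold := SymplecticManifold {
  symplectic_space :> manifold R;
  symplectic_form : two_form symplectic_space;
  symplectic_closed : closed2 symplectic_form;
  symplectic_nondegenerate : nondegenerate symplectic_form }.

(* The bundle map of the bivector inverse to omega, with the sign convention
   omega(v, pi(alpha)) = alpha(v), hence {F, G} = omega(X_F, X_G).  Replacing omega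
   by - omega gives the other usual convention.  The defining set is a singleton
   by nondegeneracy. *)
Definition symplectic_sharp (W : symplectic_manifold) (w : W)
    (alpha : cotangent w) : tangent w :=
  xget 0 [set u | forall v : tangent w, symplectic_form W w v u = alpha v].

Definition symplectic_ham (W : symplectic_manifold) (F : cinf W) (w : W) :
  tangent w := symplectic_sharp (cdiff F w).

Definition symplectic_bracket (W : symplectic_manifold) (F G : cinf W) (w : W)
  : R := symplectic_ham F w G.

Section Maps.
Variables (W : symplectic_manifold) (P : poisson_manifold R) (rho : smap W P).

Definition poisson_map := forall (f g : cinf P) (w : W),
  symplectic_bracket (pullback rho f) (pullback rho g) w
  = bracket (poisson_biv P) f g (rho w).

Definition anti_poisson_map := forall (f g : cinf P) (w : W),
  symplectic_bracket (pullback rho f) (pullback rho g) w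
  = - bracket (poisson_biv P) f g (rho w).

(* The pullback of the flow of X_f is the flow of X_(rho^* f), up to the sign of
   time when rho is anti-Poisson. *)
Definition complete_map := forall f : cinf P,
  complete_vf (ham f) -> complete_vf (symplectic_ham (pullback rho f)).

Definition surjective_submersion :=
  submersion rho /\ forall p, exists w, rho w = p.

(* X_F is projectable along rho, with rho_* X_F = xi. *)
Definition projects_to (F : cinf W) (xi : forall p : P, tangent p) :=
  forall w, tmap rho (symplectic_ham F w) = xi (rho w).
End Maps.

(* The tangent space at w of the fibre of rho through w is the kernel of the
   tangent map: ker T sigma is the omega-orthogonal of ker T rho. *)
Definition symplectically_orthogonal (W : symplectic_manifold)
    (M N : manifold R) (rho : smap W M) (sigma : smap W N) :=
  forall (w : W) (u : tangent w), tmap sigma u = 0 <->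
    (forall v : tangent w, tmap rho v = 0 -> symplectic_form W w u v = 0).

Record complete_full_dual_pair (P1 P2 : poisson_manifold R)
    (W : symplectic_manifold) (rho1 : smap W P1) (rho2 : smap W P2) : Prop := {
  dual_pair_submersion1 : surjective_submersion rho1;
  dual_pair_submersion2 : surjective_submersion rho2;
  dual_pair_poisson : poisson_map rho1;
  dual_pair_anti_poisson : anti_poisson_map rho2;
  dual_pair_orthogonal12 : symplectically_orthogonal rho1 rho2;
  dual_pair_orthogonal21 : symplectically_orthogonal rho2 rho1;
  dual_pair_complete1 : complete_map rho1;
  dual_pair_complete2 : complete_map rho2 }.

(* Every loop in F, for the subspace topology, contracts in F relative to its
   base point; connectedness is stated separately. *)
Definition simply_connected (T : topologicalType) (F : set T) :=
  forall gamma : R -> T, {within `[0, 1], continuous gamma} ->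
    (forall t, t \in `[0, 1] -> F (gamma t)) -> gamma 0 = gamma 1 ->
  exists H : R * R -> T,
    [/\ {within `[0, 1] `*` `[0, 1], continuous H},
        forall s t, s \in `[0, 1] -> t \in `[0, 1] -> F (H (s, t)),
        forall t, t \in `[0, 1] -> H (0, t) = gamma t /\ H (1, t) = gamma 0 &
        forall s, s \in `[0, 1] -> H (s, 0) = gamma 0 /\ H (s, 1) = gamma 0].

Definition connected_simply_connected_fibers (M N : manifold R)
    (rho : smap M N) :=
  forall p : N, connected (rho @^-1` [set p]) /\
    simply_connected (rho @^-1` [set p]).

Definition ginzburg_lu_isomorphism (P1 P2 : poisson_manifold R)
    (W : symplectic_manifold) (rho1 : smap W P1) (rho2 : smap W P2)
    (E : {linear poisson_H1 P1 -> poisson_H1 P2}) :=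
  bijective E /\
  forall (xi1 : poisson_vfield P1) (xi2 : poisson_vfield P2),
    E (qclass (hamiltonian_subspace P1) xi1)
      = qclass (hamiltonian_subspace P2) xi2 <->
    exists F : cinf W,
      projects_to rho1 F xi1 /\ projects_to rho2 F (fun p => - xi2 p).

End Morita.

(* Main.v *)
From HB Require Import structures.
Require Import Defs.
From mathcomp Require Import all_boot all_order all_algebra.
From mathcomp Require Import all_classical all_reals all_analysis.
From mathcomp Require Import ring lra.

(** Tangentiality to the symplectic leaves is transported by the dual pair:
    if T rho1 (X_F) = pi1(dg) at a point w, then X_F - X_(rho1^* g) lies in
    ker T rho1 = (ker T rho2)^omega, so it equals X_(rho2^* h) for some h,
    while X_(rho1^* g) lies in (ker T rho1)^omega = ker T rho2; hence T rho2
    (X_F) is a multiple of pi2(dh). On a regular Poisson manifold the image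
    of pi^* consists of the classes of the Poisson vector fields xi tangent
    to the leaves: the form alpha with alpha(X_f) = xi(f) is smooth because
    locally every section of TF is a combination, with smooth coefficients,
    of finitely many Hamiltonian vector fields, and it is closed because d_F
    alpha is tensorial and vanishes on Hamiltonian vector fields by L_xi pi
    = 0. Since pi^* is injective, E restricts to an isomorphism of the
    leafwise cohomology spaces. *)

Set Implicit Arguments.
Unset Strict Implicit.
Unset Printing Implicit Defensive.

Import Order.TTheory GRing.Theory Num.Theory.
Import numFieldNormedType.Exports.
Local Open Scope classical_set_scope.
Local Open Scope ring_scope.

(** * Linear forms *)

Section Forms.
Variables (R : realType) (V : lmodType R).
Implicit Types (D : Defs.subspace V) (u v : V).

Lemma ldual_linear (phi : ldual V) a u v : phi (a *: u + v) = a * phi u + phi v.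
Proof. exact: (eltP phi a u v). Qed.

Lemma ldual0 (phi : ldual V) : phi 0 = 0.
Proof. by have := ldual_linear phi 1 0 0; rewrite scaler0 addr0; lra. Qed.

Lemma ldualZ (phi : ldual V) a u : phi (a *: u) = a * phi u.
Proof. by rewrite -[a *: u]addr0 ldual_linear ldual0 addr0. Qed.

Lemma ldualD (phi : ldual V) u v : phi (u + v) = phi u + phi v.
Proof. by rewrite -[u]scale1r ldual_linear scale1r mul1r. Qed.

Lemma ldualN (phi : ldual V) u : phi (- u) = - phi u.
Proof. by rewrite -scaleN1r ldualZ mulN1r. Qed.

Lemma ldualB (phi : ldual V) u v : phi (u - v) = phi u - phi v.
Proof. by rewrite ldualD ldualN. Qed.

Lemma ldual_sum (phi : ldual V) I (r : seq I) (c : I -> R) (b : I -> V) :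
  phi (\sum_(i <- r) c i *: b i) = \sum_(i <- r) c i * phi (b i).
Proof.
elim: r => [|i r IH]; first by rewrite !big_nil ldual0.
by rewrite !big_cons ldual_linear IH.
Qed.

Lemma subspaceZ D a u : D u -> D (a *: u).
Proof.
move=> Du; rewrite -[_ *: _]addr0; apply: subspaceP => //.
exact: subspace0.
Qed.

Lemma subspaceB D u v : D u -> D v -> D (u - v).
Proof. by move=> Du Dv; rewrite addrC -scaleN1r; exact: subspaceP. Qed.

End Forms.

(** * Separation and extension of linear forms by Zorn's lemma *)

Section Separation.
Variables (R : realType) (V : lmodType R).
Implicit Types (D : Defs.subspace V) (u v : V).

(** Zorn's lemma gives a maximal subspace [T] containing [D] and missing [u]; adjoining a vector
    outside [T] must then capture [u]. No finiteness is assumed: tangent spaces are spaces of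
    derivations whose dimension is not computed. *)
Lemma maximal_avoiding_subspace D u : ~ D u -> exists T : Defs.subspace V,
  [/\ forall v, D v -> T v, ~ T u &
      forall v, ~ T v -> exists2 c, T (u - c *: v) & c != 0].
Proof.
move=> nDu.
pose lin (A : set V) := forall a x y, A x -> A y -> A (a *: x + y).
(* Zorn's lemma also asks for the union of the empty chain; joining [D] to [A] makes the empty set
   admissible. *)
pose good (A : set V) := lin ([set` in_subspace D] `|` A) /\ ~ A u.
have inD v : [set` in_subspace D] v <-> D v.
  by split=> [/asboolP|Dv] //; exact/asboolP.
have [F goodF totF|A [[linA nAu] maxA]] := @Zorn_bigcup V good.
  split=> [a x y|[A /goodF[]]//].
  move=> [Dx|[A FA Ax]] [Dy|[B FB By]].
  - by left; apply/inD; apply: subspaceP; exact/inD.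
  - have [/(_ a x y (or_introl Dx) (or_intror By))[]] := goodF _ FB.
      by left.
    by right; exists B.
  - have [/(_ a x y (or_intror Ax) (or_introl Dy))[]] := goodF _ FA.
      by left.
    by right; exists A.
  - have [C [FC Cx Cy]] : exists C, [/\ F C, C x & C y].
      have [AB|BA] := totF _ _ FA FB; first by exists B; split=> //; exact: AB.
      by exists A; split=> //; exact: BA.
    have [/(_ a x y (or_intror Cx) (or_intror Cy))[]] := goodF _ FC.
      by left.
    by right; exists C.
pose T := [set` in_subspace D] `|` A.
have T0 : T 0 by left; apply/inD; exact: subspace0.
pose TS := @Subspace _ _ T T0 linA.
have nTu : ~ T u by move=> [/inD|].
exists TS; split=> // [v Dv|v nTv]; first by left; exact/inD.
(* [B] is [T + R v]; if it missed [u], it would contradict maximality. *)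
pose B : set V := [set x | exists a, TS (x - a *: v)].
have TB x : TS x -> B x by move=> Tx; exists 0; rewrite scale0r subr0.
have [] := pselect (B u).
  move=> [c Tc]; exists c => //; apply/eqP => c0; apply: nTu.
  by move: Tc; rewrite c0 scale0r subr0.
move=> nBu; exfalso; apply: (maxA B).
  rewrite properEneq; split; last by move=> y Ay; apply: TB; right.
  apply/eqP => AB; apply: nTv; right; rewrite AB.
  by exists 1; rewrite scale1r subrr.
split=> // a x y.
have -> : [set` in_subspace D] `|` B = B.
  by apply/setUidPr => z Dz; apply: TB; left.
move=> [b Tx] [c Ty]; exists (a * b + c).
suff -> : a *: x + y - (a * b + c) *: v = a *: (x - b *: v) + (y - c *: v).
  exact: subspaceP.
by rewrite scalerBr scalerA scalerDl opprD addrACA.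
Qed.

(** The maximal [T] is a hyperplane complementary to the line of [u]; [phi] reads off the
    coefficient of [u]. *)
Lemma separating_form D u : ~ D u ->
  exists phi : ldual V, (forall v, D v -> phi v = 0) /\ phi u = 1.
Proof.
move=> nDu; have [T [DT nTu Tu]] := maximal_avoiding_subspace nDu.
have coef v : {c | T (v - c *: u)}.
  apply: cid; have [Tv|nTv] := pselect (T v).
    by exists 0; rewrite scale0r subr0.
  have [c Tc c0] := Tu _ nTv; exists c^-1.
  have := subspaceZ (- c^-1) Tc.
  by rewrite scalerBr scalerA mulNr mulVf // scaleN1r opprK scaleNr addrC.
(* Two distinct coefficients would put a nonzero multiple of [u] into [T]. *)
have coefE v c : T (v - c *: u) -> sval (coef v) = c.
  case: (coef v) => c' /= Tc' Tc; apply: contrapT => cc'; apply: nTu.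
  have /(subspaceZ (c - c')^-1) := subspaceB Tc' Tc.
  have -> : v - c' *: u - (v - c *: u) = (c - c') *: u.
    by rewrite opprB addrC addrA subrK scalerBl.
  rewrite scalerA mulVf ?scale1r //.
  by apply/eqP => /subr0_eq e; apply: cc'.
have lin : linear_form_subspace V (fun v => sval (coef v)).
  move=> a x y; apply: coefE.
  have Tx := svalP (coef x); have Ty := svalP (coef y).
  suff -> : a *: x + y - (a * sval (coef x) + sval (coef y)) *: u
    = a *: (x - sval (coef x) *: u) + (y - sval (coef y) *: u).
    exact: subspaceP.
  by rewrite scalerBr scalerA scalerDl opprD addrACA.
exists (mk_elt lin); split=> [v /DT Tv|].
  by apply: coefE; rewrite scale0r subr0.
by apply: coefE; rewrite scale1r subrr; exact: subspace0.
Qed.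

(** If [alpha s0 != 0], the kernel of [alpha], viewed in [V], misses [s0]. A form that kills this
    kernel and is 1 at [s0], multiplied by [alpha s0], extends [alpha]. *)
Lemma ldual_extension D (alpha : ldual (elt D)) :
  exists phi : ldual V, forall s : elt D, alpha s = phi (elt_val s).
Proof.
have [[s0 as0]|a0] := pselect (exists s0, alpha s0 != 0); last first.
  exists 0 => s; apply: contrapT => as0; apply: a0; exists s.
  by apply/eqP => as0'; apply: as0; rewrite as0'.
pose kerP v := exists2 s : elt D, elt_val s = v & alpha s = 0.
have ker0 : kerP 0 by exists 0; last exact: ldual0.
have ker_lin a u v : kerP u -> kerP v -> kerP (a *: u + v).
  move=> [s <- s0'] [t <- t0]; exists (a *: s + t) => //.
  by rewrite ldual_linear s0' t0 mulr0 addr0.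
pose K := Subspace ker0 ker_lin.
have [|phi [phiK phi1]] := @separating_form K (elt_val s0).
  move=> [s ss0]; have -> : s = s0 by exact/val_inj.
  by move/eqP; rewrite (negbTE as0).
pose a := alpha s0.
have L : linear_form_subspace V (fun v => a * phi v).
  by move=> b x y; rewrite ldual_linear; ring.
exists (mk_elt L) => s; rewrite -[RHS]/(a * phi (elt_val s)).
have : phi (elt_val (s - (alpha s / a) *: s0)) = 0.
  by apply: phiK; eexists => //; rewrite ldualB ldualZ divfK ?subrr.
rewrite -[elt_val _]/(elt_val s - (alpha s / a) *: elt_val s0).
rewrite ldualB ldualZ phi1 mulr1 => /eqP; rewrite subr_eq0 => /eqP ->.
by rewrite mulrC divfK.
Qed.

End Separation.

(** * Local quotients of smooth functions *)

(** [g - f] vanishes near [x], so its differential there is 0, and [g = f + (g - f)]. *)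
Lemma is_diff_near (R : realType) (V W : normedModType R) (f g df : V -> W)
    (x : V) :
  (\forall y \near x, f y = g y) -> is_diff x f df -> is_diff x g df.
Proof.
move=> fg dfx.
have e0 : is_diff x (g - f) (\0 : V -> W).
  have zc : continuous (\0 : V -> W) by move=> z; exact: cst_continuous.
  have E : (g - f) \o shift x = cst ((g - f) x) + \0 +o_ 0 id.
    apply/eqaddoP => eps eps0; near=> z.
    have gf : (g - f) (z + x) = 0.
      apply/eqP; rewrite subr_eq0; apply/eqP/esym; near: z.
      have : z + x @[z --> 0] --> x.
        rewrite -[X in _ --> X]add0r; apply: cvgD; first exact: cvg_id.
        exact: cvg_cst.
      by move=> /(_ _ fg).
    have gfx : (g - f) x = 0.
      apply/eqP; rewrite subr_eq0; apply/eqP/esym.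
      exact: (nbhs_singleton fg).
    rewrite -[X in `|X|]/((g - f) (z + x) - ((g - f) x + 0)) gf gfx !addr0.
    by rewrite subr0 normr0 mulr_ge0 // ltW.
  have D : 'd (g - f) x = \0 :> (V -> W) by exact: diff_unique.
  by apply: DiffDef => //; apply/diff_locallyP; rewrite D.
have -> : g = f + (g - f) by rewrite addrC subrK.
have -> : df = df + \0 by apply/funext => z; rewrite -[RHS]/(df z + 0) addr0.
exact: is_diffD.
Unshelve. all: by end_near. Qed.

Lemma continuous_near (T V : topologicalType) (f g : T -> V) (x : T) :
  (\forall y \near x, f y = g y) ->
  {for x, continuous f} -> {for x, continuous g}.
Proof.
move=> fg; rewrite /prop_for /continuous_at -(nbhs_singleton fg).
by apply: cvg_trans; apply: near_eq_cvg; apply: filterS fg => y ->.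
Qed.

Section LocalQuotients.
Variables (R : realType) (n : nat).
Implicit Types (U : set 'rV[R]_n) (f g h : 'rV[R]_n -> R).

Lemma Ck_eq_in k U f g : open U -> (forall x, U x -> f x = g x) ->
  Ck k U f -> Ck k U g.
Proof.
move=> oU fg; have near_eq x : U x -> \forall y \near x, f y = g y.
  by move=> Ux; exact: (filterS _ (open_nbhs_nbhs (conj oU Ux))).
case: k => [|k] Cf /=.
  by move=> x Ux; exact: continuous_near (near_eq _ Ux) (Cf x Ux).
have [df [fdf Cdf]] := Cf; exists df; split=> // x Ux.
exact: is_diff_near (near_eq _ Ux) (fdf x Ux).
Qed.

Lemma Csmooth_diff U f v : open U -> Csmooth U f ->
  Csmooth U (fun x => 'd f x v).
Proof.
move=> oU Cf k; have [df [fdf Cdf]] := Cf k.+1.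
by apply: Ck_eq_in (Cdf v) => // x Ux; have [_ ->] := fdf x Ux.
Qed.

Lemma Csmooth_is_diff U f x : Csmooth U f -> U x -> is_diff x f ('d f x).
Proof.
by move=> Cf Ux; apply: differentiableP; have [df [/(_ x Ux)[]]] := Cf 1%N.
Qed.

(** Induction on the order of differentiability, the hypothesis being the invariant: by the quotient
    rule each directional derivative of [phi] satisfies a relation of the same shape, with
    denominator [d^2]. *)
Lemma Csmooth_local_quotient U phi : open U ->
  (forall x, U x -> exists d m, [/\ Csmooth U d, Csmooth U m, d x != 0 &
     forall y, U y -> d y != 0 -> d y * phi y = m y]) -> Csmooth U phi.
Proof.
move=> oU quot0 k; move: quot0.
have near_nz d x : U x -> Csmooth U d -> d x != 0 ->
    \forall y \near x, U y /\ d y != 0.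
  move=> Ux sd dx0; apply: filterI; first exact: (open_nbhs_nbhs (conj oU Ux)).
  exact: cvgr_neq0 (sd 0%N x Ux) dx0.
have near_phi psi d m x : U x -> Csmooth U d -> d x != 0 ->
    (forall y, U y -> d y != 0 -> d y * psi y = m y) ->
    \forall y \near x, (d y)^-1 * m y = psi y.
  move=> Ux sd dx0 dm; apply: (filterS _ (near_nz d x Ux sd dx0)).
  by move=> y [Uy dy0]; rewrite -(dm y Uy dy0) mulKf.
elim: k phi => [|k IH] phi quot.
  move=> x Ux; have [d [m [sd sm dx0 dm]]] := quot x Ux.
  have [cd cm] := (sd 0%N x Ux, sm 0%N x Ux).
  apply: continuous_near (near_phi _ _ _ _ Ux sd dx0 dm) _.
  exact: cvgM (cvgV dx0 cd) cm.
have dphi x : U x -> is_diff x phi ('d phi x).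
  move=> Ux; have [d [m [sd sm dx0 dm]]] := quot x Ux.
  have [dd dm'] := (Csmooth_is_diff sd Ux, Csmooth_is_diff sm Ux).
  have dq : differentiable (fun y => (d y)^-1 * m y) x.
    by apply: differentiableM; [exact: differentiableV|].
  have /is_diff_near /(_ (differentiableP dq)) [+ _] :=
    near_phi _ _ _ _ Ux sd dx0 dm.
  exact: differentiableP.
exists (fun x v => 'd phi x v); split=> // v.
apply: IH => x Ux; have [d [m [sd sm dx0 dm]]] := quot x Ux.
(* Differentiating [d phi = m] and multiplying by [d] gives [d^2 phi' = d m' - m d']. *)
exists (fun y => d y * d y),
  (fun y => d y * 'd m y v + (-1) * (m y * 'd d y v)).
have [sd' sm'] := (Csmooth_diff v oU sd, Csmooth_diff v oU sm).
split.
- by move=> j; apply: CkM; exact: sd || exact: sd'.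
- move=> j; apply: CkD; first by apply: CkM; [exact: sd|exact: sm'].
  by apply: CkM; [exact: Ck_cst|apply: CkM; [exact: sm|exact: sd']].
- by rewrite mulf_neq0.
move=> y Uy; rewrite mulf_eq0 orbb => dy0.
have near_dm : \forall z \near y, (d * phi) z = m z.
  apply: (filterS _ (near_nz _ _ Uy sd dy0)) => z [Uz dz0]; exact: dm.
have dy := Csmooth_is_diff sd Uy.
have := is_diff_near near_dm (is_diffM dy (dphi y Uy)).
case=> _ ->; rewrite -(dm _ Uy dy0).
rewrite -[(d y *: _ + _) v]/(d y * 'd phi y v + phi y * 'd d y v); ring.
Qed.

End LocalQuotients.

Section SmoothQuotient.
Variables (R : realType) (M : manifold R).

Lemma cinfME (f g : cinf M) p : (f * g) p = f p * g p. Proof. by []. Qed.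

Lemma cinf_sumE I (r : seq I) (P : pred I) (F : I -> cinf M) p :
  (\sum_(i <- r | P i) F i) p = \sum_(i <- r | P i) F i p.
Proof. by elim/big_rec2: _ => // i x y _ <-. Qed.

Lemma smooth_local_quotient (phi : M -> R) :
  (forall p, exists d m : cinf M, d p != 0 /\
     forall q, d q != 0 -> d q * phi q = m q) -> smooth phi.
Proof.
move=> quot c Ac; apply: Csmooth_local_quotient.
  by rewrite setIT; exact: cimg_open.
move=> _ [p [cp _] <-]; have [d [m [dp dm]]] := quot p.
exists (d \o cinv c), (m \o cinv c); split=> [| | |y _ dy].
- exact: (cinfP d Ac).
- exact: (cinfP m Ac).
- by rewrite /= cmapK.
- exact: dm.
Qed.

End SmoothQuotient.

(** * Linear algebra of a dual pair *)

Section SymplecticLinear.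
Variables (R : realType) (W : symplectic_manifold R).
Local Notation omega := (symplectic_form W).
Implicit Types (w : W) (F : cinf W).

Lemma form2_linearr w a (u v x : tangent w) :
  omega w x (a *: u + v) = a * omega w x u + omega w x v.
Proof. by rewrite form2_anti form2_linear opprD -mulrN -!(form2_anti _ x). Qed.

Definition omega_form w (u : tangent w) : cotangent w :=
  mk_elt ((fun a x y => form2_linear omega a x y u) :
    linear_form_subspace (tangent w) (fun v : tangent w => omega w v u)).

Lemma omega_inj w (u u' : tangent w) :
  (forall v, omega w v u = omega w v u') -> u = u'.
Proof.
move=> uu'; have [x [_ xP]] := symplectic_nondegenerate (omega_form u).
by transitivity x; [apply/esym|]; apply: xP => // v; rewrite -uu'.
Qed.

Lemma symplectic_sharpE w (alpha : cotangent w) v :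
  omega w v (symplectic_sharp alpha) = alpha v.
Proof.
have [x [xP _]] := symplectic_nondegenerate alpha.
suff : [set u | forall v : tangent w, omega w v u = alpha v]
  (symplectic_sharp alpha) by exact.
by apply: xgetPex; exists x.
Qed.

Lemma omega_ham w F v : omega w v (symplectic_ham F w) = v F.
Proof. exact: symplectic_sharpE. Qed.

Section Submersion.
Variables (P : manifold R) (rho : smap W P).

Lemma tmap_linear w a (u v : tangent w) :
  tmap rho (a *: u + v) = a *: tmap rho u + tmap rho v.
Proof. exact/val_inj. Qed.

Lemma tmapB w (u v : tangent w) : tmap rho (u - v) = tmap rho u - tmap rho v.
Proof. exact/val_inj. Qed.

Fact pullback_covector_proof w (a : cotangent (rho w)) :
  linear_form_subspace (tangent w) (fun v : tangent w => a (tmap rho v)).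
Proof. by move=> b u v; rewrite tmap_linear; exact: ldual_linear. Qed.

Definition pullback_covector w (a : cotangent (rho w)) : cotangent w :=
  mk_elt (pullback_covector_proof a).

Lemma pullback_ham_subspace0 w :
  exists g : cinf P, (0 : tangent w) = symplectic_ham (pullback rho g) w.
Proof.
exists 0; apply: omega_inj => v; rewrite omega_ham.
have -> : pullback rho 0 = 0 :> cinf W by exact/val_inj.
by rewrite tangent0; exact: (ldual0 (mk_elt
  ((fun a x y => form2_linearr a x y v) :
    linear_form_subspace (tangent w) (fun u : tangent w => omega w v u)))).
Qed.

Lemma pullback_ham_subspaceP w a (u v : tangent w) :
  (exists g, u = symplectic_ham (pullback rho g) w) ->
  (exists g, v = symplectic_ham (pullback rho g) w) ->
  exists g, a *: u + v = symplectic_ham (pullback rho g) w.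
Proof.
move=> [g ->] [h ->]; exists (a *: g + h); apply: omega_inj => x.
rewrite form2_linearr !omega_ham -tangent_linear; congr (x _).
exact/val_inj.
Qed.

Hypothesis subm : submersion rho.

(* If the Hamiltonian vectors of pullbacks missed omega^-1 (rho^* a), some
   vector u would be omega-orthogonal to all of them but not to
   omega^-1 (rho^* a); the former says T rho u = 0, contradicting the latter. *)
Lemma covector_cdiff w (a : cotangent (rho w)) :
  exists g, a = cdiff g (rho w).
Proof.
pose D := Subspace (pullback_ham_subspace0 w) (@pullback_ham_subspaceP w).
pose u1 := symplectic_sharp (pullback_covector a).
have [[g u1g]|nDu] := pselect (D u1).
  exists g; apply/val_inj/funext => y; have [v <-] := subm y.
  rewrite -[LHS]/(pullback_covector a v) -symplectic_sharpE.
  by rewrite -/u1 u1g omega_ham.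
have [phi [phiD phi1]] := separating_form nDu.
pose u := symplectic_sharp (phi : cotangent w).
have uE v : omega w v u = phi v by exact: symplectic_sharpE.
have u0 : tmap rho u = 0.
  apply/val_inj/funext => g; rewrite -[LHS]/(u (pullback rho g)).
  rewrite -omega_ham form2_anti uE phiD ?oppr0 //.
  by exists g.
have := uE u1; rewrite phi1 form2_anti symplectic_sharpE.
rewrite -[X in - X]/(a (tmap rho u)) u0 -[X in - X]/(ldual_fun a 0) ldual0.
by lra.
Qed.

(** [c] depends only on the image under T rho, so its value on any chosen lift defines the form
    downstairs. *)
Lemma descend_covector w (c : cotangent w) :
  (forall v, tmap rho v = 0 -> c v = 0) ->
  exists a : cotangent (rho w), forall v, c v = a (tmap rho v).
Proof.
move=> c0.
pose lift y := sval (cid (@subm w y)).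
have liftE y : tmap rho (lift y) = y by rewrite /lift; case: cid.
have cE u v : tmap rho u = tmap rho v -> c u = c v.
  move=> uv; apply/eqP; rewrite -subr_eq0.
  rewrite -[_ - _]/(ldual_fun c u - ldual_fun c v).
  by rewrite -ldualB; apply/eqP/c0; rewrite tmapB uv subrr.
have L : linear_form_subspace (tangent (rho w)) (fun y => c (lift y)).
  move=> a x y; rewrite -[RHS](ldual_linear c); apply: cE.
  by rewrite tmap_linear !liftE.
by exists (mk_elt L) => v; apply: cE; rewrite liftE.
Qed.

End Submersion.

(** [eps = 1] is a Poisson map and [eps = -1] an anti-Poisson one, so that one argument serves both
    legs of the dual pair. *)
Definition scaled_poisson (P : poisson_manifold R) (rho : smap W P) (eps : R) :=
  forall f g w, symplectic_bracket (pullback rho f) (pullback rho g) w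
    = eps * bracket (poisson_biv P) f g (rho w).

Lemma tmap_ham (P : poisson_manifold R) (rho : smap W P) eps :
  scaled_poisson rho eps -> forall f w,
  tmap rho (symplectic_ham (pullback rho f) w) = eps *: ham f (rho w).
Proof. by move=> pr f w; apply/val_inj/funext => g; exact: pr. Qed.

Lemma leaf_transfer (P Q : poisson_manifold R) (rho : smap W P)
    (sigma : smap W Q) (eps eta : R) :
  eps != 0 -> scaled_poisson rho eps -> scaled_poisson sigma eta ->
  submersion rho -> submersion sigma ->
  symplectically_orthogonal rho sigma -> symplectically_orthogonal sigma rho ->
  forall w (u : tangent w), leaf_subspace (rho w) (tmap rho u) ->
    leaf_subspace (sigma w) (tmap sigma u).
Proof.
move=> eps0 prho psigma srho ssigma orth orth' w u [b uE].
have [g bE] := covector_cdiff srho b.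
(* Since T rho sends the Hamiltonian vector of [pullback rho g] to [eps] times that of [g], this
   [u1] has the same image as [u]. *)
pose u1 := eps^-1 *: symplectic_ham (pullback rho g) w.
have tmapZ (M : manifold R) (tau : smap W M) a (v : tangent w) :
  tmap tau (a *: v) = a *: tmap tau v by exact/val_inj.
have rho1 : tmap rho u1 = tmap rho u.
  by rewrite tmapZ (tmap_ham prho) scalerA mulVf // scale1r uE bE.
(* Pairing [v] with the Hamiltonian vector of [pullback rho g] gives [tmap rho v g], so [u1] is
   orthogonal to ker T rho. *)
have sigma1 : tmap sigma u1 = 0.
  apply/orth => v v0; rewrite form2_anti -[u1]addr0 form2_linearr omega_ham.
  have -> : omega w v 0 = 0.
    rewrite form2_anti -[omega w 0 v]/(ldual_fun (omega_form v) 0).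
    by rewrite ldual0 oppr0.
  rewrite -[X in _ * X]/(tmap rho v g) v0 -[tangent_fun 0 g]/(0 : R).
  by rewrite mulr0 addr0 oppr0.
have : tmap rho (u - u1) = 0 by rewrite tmapB rho1 subrr.
move/orth' => z0.
(* [u - u1] is orthogonal to ker T sigma, so pairing with it descends to a covector at [sigma w]. *)
have [v v0|a aE] := @descend_covector _ sigma ssigma w (omega_form (u - u1)).
  by rewrite -[LHS]/(omega w v (u - u1)) form2_anti z0 // oppr0.
have [h ah] := covector_cdiff ssigma a.
have zE : u - u1 = symplectic_ham (pullback sigma h) w.
  by apply: omega_inj => v; rewrite omega_ham [LHS]aE ah.
have -> : tmap sigma u = eta *: ham h (sigma w).
  by rewrite -(tmap_ham psigma) -zE tmapB sigma1 subr0.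
exact: subspaceZ (ham_leaf h _).
Qed.

End SymplecticLinear.

(** * Hamiltonian frames *)

Section Frames.
Variables (R : realType) (V : lmodType R) (S : Defs.subspace V) (r : nat).

(** The coordinate matrix of the [x i] in a basis has trivial left kernel, hence is invertible; its
    inverse converts coordinates. *)
Lemma has_dim_free_spans (x : 'I_r -> V) : has_dim S r -> (forall i, S (x i)) ->
  (forall c : 'I_r -> R, \sum_i c i *: x i = 0 -> forall i, c i = 0) ->
  forall v, S v -> exists c : 'I_r -> R, v = \sum_i c i *: x i.
Proof.
move=> [b [bS bfree]] Sx xfree v /bS[d dE].
have coef i : {c : 'I_r -> R | x i = \sum_j c j *: b j}.
  exact/cid/bS.
pose A : 'M[R]_r := \matrix_(i, j) sval (coef i) j.
have xE i : x i = \sum_j A i j *: b j.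
  rewrite [LHS](svalP (coef i)); apply: eq_bigr => j _; by rewrite mxE.
have combE (c : 'rV[R]_r) :
    \sum_i c 0 i *: x i = \sum_j (c *m A) 0 j *: b j.
  under eq_bigr do rewrite xE scaler_sumr.
  rewrite exchange_big /=; apply: eq_bigr => j _.
  by rewrite mxE scaler_suml; apply: eq_bigr => i _; rewrite scalerA.
have Au : A \in unitmx.
  rewrite -row_free_unit; apply/inj_row_free => c cA0; apply/rowP => i.
  rewrite mxE; apply: (xfree (c 0)); rewrite combE cA0.
  by rewrite big1 // => j _; rewrite mxE scale0r.
exists (fun i => ((\row_j d j) *m invmx A) 0 i).
rewrite combE mulmxKV // dE; apply: eq_bigr => j _; by rewrite mxE.
Qed.

(** Separate [b j] from the span of the other vectors, encoded as the combinations whose [j]-th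
    coefficient is 0. *)
Lemma dual_form (b : 'I_r -> V) (j : 'I_r) :
  (forall c : 'I_r -> R, \sum_i c i *: b i = 0 -> forall i, c i = 0) ->
  exists phi : ldual V, forall i, phi (b i) = (i == j)%:R.
Proof.
move=> bfree.
pose spanP v := exists2 c : 'I_r -> R, c j = 0 & v = \sum_i c i *: b i.
have span0 : spanP 0.
  by exists (fun=> 0) => //; rewrite big1 // => i _; rewrite scale0r.
have span_lin a u v : spanP u -> spanP v -> spanP (a *: u + v).
  move=> [c c0 ->] [d d0 ->]; exists (fun i => a * c i + d i).
    by rewrite c0 d0 mulr0 addr0.
  rewrite scaler_sumr -big_split /=; apply: eq_bigr => i _.
  by rewrite scalerDl scalerA.
have bE i : b i = \sum_k (k == i)%:R *: b k.
  rewrite (bigD1 i) //= eqxx scale1r big1 ?addr0 // => k /negbTE ->.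
  by rewrite scale0r.
have [|phi [phi0 phi1]] := @separating_form _ _ (Subspace span0 span_lin) (b j).
  move=> [c c0 cE]; have := bfree (fun i => c i - (i == j)%:R).
  move=> /(_ _ j); rewrite c0 eqxx sub0r => h.
  have /eqP : -1 = 0 :> R; last by rewrite oppr_eq0 oner_eq0.
  apply: h; under eq_bigr do rewrite scalerBl.
  by rewrite big_split sumrN /= -cE -bE subrr.
exists phi => i; have [->|ij] := eqVneq i j; first exact: phi1.
by apply: phi0; exists (fun k => (k == i)%:R); rewrite // eq_sym (negbTE ij).
Qed.

End Frames.

Section PoissonFrames.
Variables (R : realType) (P : poisson_manifold R).
Local Notation pi := (poisson_biv P).


(** Registered as a ring morphism so that evaluation at [p] commutes with determinants and adjugates
    of matrices over [cinf P]. *)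
Definition ev (p : P) (f : cinf P) : R := f p.
Fact ev_zmod p : zmod_morphism (ev p). Proof. by []. Qed.
Fact ev_monoid p : monoid_morphism (ev p). Proof. by []. Qed.
HB.instance Definition _ p :=
  GRing.isZmodMorphism.Build (cinf P) R (ev p) (ev_zmod p).
HB.instance Definition _ p :=
  GRing.isMonoidMorphism.Build (cinf P) R (ev p) (ev_monoid p).

Lemma tangent_comb p I (s : seq I) (c : I -> R) (v : I -> tangent p)
    (h : cinf P) :
  (\sum_(i <- s) c i *: v i : tangent p) h = \sum_(i <- s) c i * v i h.
Proof. exact: (ldual_sum (cdiff h p)). Qed.

Hypothesis cdiff_onto :
  forall p (a : cotangent p), exists g, a = @cdiff R P g p.
Hypothesis reg : regular_poisson P.

(* With M_ij = {f_i, g_j} invertible at p0, X = sum_i c_i X_(f_i) gives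
   X(g_j) = (c M)_j, hence det M * c = X(g) adj M; multiplying once more by
   det M makes the identity hold where det M vanishes too. *)
Lemma ham_frame (p0 : P) : exists (r : nat) (f : 'I_r -> cinf P) (d : cinf P),
  d p0 != 0 /\ forall X : leaf_vfield P, exists N : 'I_r -> cinf P,
    forall p, d p *: X p = \sum_i N i p *: ham (f i) p.
Proof.
have [r dimr] := reg; have [b [bS bfree]] := dimr p0.
have leaf_b i : leaf_subspace p0 (b i).
  apply/bS; exists (fun k => (k == i)%:R).
  rewrite (bigD1 i) //= eqxx scale1r big1 ?addr0 // => k /negbTE ->.
  by rewrite scale0r.
have hamb i : {f | b i = ham f p0}.
  apply: cid; have [a ->] := leaf_b i; have [f ->] := cdiff_onto a.
  by exists f.
(* The differentials of these functions are dual to the basis [b], so the matrix [M] below is the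
   identity at [p0]. *)
have dualb j : {g : cinf P | forall i, (b i : tangent p0) g = (i == j)%:R}.
  apply: cid; have [phi phiE] := dual_form j bfree.
  have [g gE] := cdiff_onto (phi : cotangent p0); exists g => i.
  by rewrite -phiE gE.
pose f i := sval (hamb i); pose g j := sval (dualb j).
pose M : 'M[cinf P]_r := \matrix_(i, j) bracket pi (f i) (g j).
pose D := \det M.
have M0 : map_mx (ev p0) M = 1%:M.
  apply/matrixP => i j; rewrite !mxE -(svalP (dualb j) i) -/(g j).
  by rewrite (svalP (hamb i)).
have D0 : D p0 = 1 by rewrite -[LHS]/(ev p0 D) -det_map_mx M0 det1.
exists r, f, (D * D); split; first by rewrite cinfME D0 mulr1 oner_neq0.
move=> X; pose y : 'rV[cinf P]_r := \row_j vf_app X (g j).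
exists (fun i => D * (y *m \adj M) 0 i) => p.
rewrite cinfME; have [Dp0|Dp0] := eqVneq (D p) 0.
  by rewrite Dp0 mul0r scale0r big1 // => i _; rewrite cinfME Dp0 mul0r scale0r.
(* Where [D] does not vanish the [ham (f i)] are independent; the rank being the constant [r], they
   also span the leaf directions there. *)
have free (c : 'I_r -> R) :
    \sum_i c i *: ham (f i) p = 0 -> forall i, c i = 0.
  move=> c0; have cM : (\row_i c i) *m map_mx (ev p) M = 0.
    apply/rowP => j; rewrite mxE [RHS]mxE -[RHS]/((0 : tangent p) (g j)) -c0.
    by rewrite tangent_comb; apply: eq_bigr => i _; rewrite !mxE.
  move=> i; have : (\row_i c i) *m (D p)%:M = 0.
    rewrite -[D p]/(ev p D) -det_map_mx -mul_mx_adj mulmxA cM mul0mx //.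
  move=> /rowP /(_ i); rewrite mul_mx_scalar !mxE => /eqP.
  by rewrite mulf_eq0 (negbTE Dp0) => /eqP.
have [c cE] := has_dim_free_spans (dimr p) (fun i => ham_leaf (f i) p) free
  (eltP X p).
have yE : map_mx (ev p) y = (\row_i c i) *m map_mx (ev p) M.
  apply/rowP => j; rewrite !mxE -[LHS]/(X p (g j)) cE tangent_comb.
  by apply: eq_bigr => i _; rewrite !mxE.
rewrite cE scaler_sumr; apply: eq_bigr => i _; rewrite scalerA cinfME.
congr (_ *: _); rewrite -mulrA; congr (_ * _).
rewrite -[RHS]/(ev p ((y *m \adj M) 0 i)).
have -> : ev p ((y *m \adj M) 0 i) = (map_mx (ev p) (y *m \adj M)) 0 i.
  by rewrite [RHS]mxE.
rewrite map_mxM map_mx_adj yE -mulmxA mul_mx_adj det_map_mx mul_mx_scalar !mxE.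
by [].
Qed.

End PoissonFrames.

(** * Leafwise potentials of Poisson vector fields *)

Section LeafwisePotential.
Variables (R : realType) (P : poisson_manifold R).
Local Notation pi := (poisson_biv P).
Hypothesis cdiff_onto :
  forall p (a : cotangent p), exists g, a = @cdiff R P g p.

(** Once both covectors are differentials, this is antisymmetry of the bivector. *)
Lemma covector_sharp (p : P) (a b : cotangent p) : a (sharp b) = - b (sharp a).
Proof.
have [f ->] := cdiff_onto a; have [g ->] := cdiff_onto b.
exact: biv_anti.
Qed.

Lemma cotangentN (p : P) (a : cotangent p) v :
  (- a : cotangent p) v = - a v.
Proof. by []. Qed.

(** Extend [alpha] at [p] to a covector [a] on the whole tangent space; antisymmetry turns the
    defining formula into [sharp (- a)]. *)
Lemma sharp_form_leaf (alpha : closed_form P) p :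
  leaf_subspace p (sharp_form alpha p).
Proof.
have [a aE] := ldual_extension ((alpha : leaf_form P) p).
exists (- (a : cotangent p)); apply/val_inj/funext => f.
rewrite -[LHS]/((alpha : leaf_form P) p (leaf_ham f p)).
apply: etrans (aE _) _.
rewrite -[RHS]/(cdiff f p (sharp (- (a : cotangent p)))).
by rewrite covector_sharp cotangentN opprK.
Qed.

(** The covectors are chosen point by point, with no smoothness in [p]; only their restriction to
    the leaves is determined by [xi]. *)
Lemma leaf_potential (xi : vfield P) : (forall p, leaf_subspace p (xi p)) ->
  exists a : forall p : P, cotangent p, forall p f, a p (ham f p) = xi p f.
Proof.
move=> xileaf; exists (fun p => - sval (cid (xileaf p))) => p f.
case: cid => b /= ->.
by rewrite -[LHS]/(- b (sharp (cdiff f p))) covector_sharp opprK.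
Qed.

Hypothesis reg : regular_poisson P.

Section Closed.
Variables (xi : vfield P) (a : forall p : P, cotangent p).
Hypothesis aP : forall p f, a p (ham f p) = xi p f.

(** In a Hamiltonian frame, [d X = sum N_i X_(f_i)] gives [d a(X) = sum N_i xi(f_i)], a local
    quotient of smooth functions. *)
Lemma leaf_potential_smooth (X : leaf_vfield P) : smooth (fun p => a p (X p)).
Proof.
apply: smooth_local_quotient => p.
have [r [f [d [d0 /(_ X)[N NE]]]]] := ham_frame cdiff_onto reg p.
exists d, (\sum_i N i * vf_app xi (f i)); split=> // q _.
rewrite -[LHS](ldualZ (a q)) NE [LHS]ldual_sum cinf_sumE.
by apply: eq_bigr => i _; congr (_ * _); exact: aP.
Qed.

Definition potential_app (X : leaf_vfield P) : cinf P :=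
  mk_cinf (leaf_potential_smooth X).

Lemma tangent_sum (p : P) (v : tangent p) I (s : seq I) (F : I -> cinf P) :
  v (\sum_(i <- s) F i) = \sum_(i <- s) v (F i).
Proof.
elim: s => [|i s IH]; first by rewrite !big_nil tangent0.
by rewrite !big_cons -[F i]scale1r tangent_linear IH scale1r mul1r.
Qed.

(* d_F a (X, Y) is C^oo-linear in Y, and d Y with d(p) <> 0 is a combination of
   Hamiltonian vector fields. *)
Lemma d_potential_tensorial (X : vfield P) (aX : cinf P) :
  (forall g p,
    X p (vf_app xi g) - ham g p aX - a p (lie X (ham_vfield g) p) = 0) ->
  forall (Y : leaf_vfield P) p,
    X p (potential_app Y) - Y p aX - a p (lie X Y p) = 0.
Proof.
move=> Xham Y p.
have [r [f [d [d0 /(_ Y)[N NE]]]]] := ham_frame cdiff_onto reg p.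
have YE (h : cinf P) : d * vf_app Y h = \sum_i N i * bracket pi (f i) h.
  apply/val_inj/funext => q.
  rewrite -[RHS]/((\sum_i N i * bracket pi (f i) h) q).
  rewrite cinf_sumE -[LHS]/((d q *: Y q : tangent q) h) NE tangent_comb.
  by [].
have aYE : d * potential_app Y = \sum_i N i * vf_app xi (f i).
  apply/val_inj/funext => q; rewrite -[RHS]/((\sum_i N i * vf_app xi (f i)) q).
  rewrite cinf_sumE -[LHS]/(d q * a q (Y q)).
  rewrite -[LHS](ldualZ (a q)) NE [LHS]ldual_sum.
  by apply: eq_bigr => i _; congr (_ * _); exact: aP.
have XaY : d p * X p (potential_app Y) + a p (Y p) * X p d =
    \sum_i (N i p * X p (vf_app xi (f i)) + xi p (f i) * X p (N i)).
  rewrite -[LHS](tangent_leibniz (X p)) aYE tangent_sum.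
  by apply: eq_bigr => i _; rewrite tangent_leibniz.
have YaX : d p * Y p aX = \sum_i N i p * ham (f i) p aX.
  by rewrite -tangent_comb -NE.
have lieE : d p *: lie X Y p + X p d *: Y p =
    \sum_i N i p *: lie X (ham_vfield (f i)) p
    + \sum_i X p (N i) *: ham (f i) p.
  apply/val_inj/funext => h.
  rewrite -[LHS]/(d p * (X p (vf_app Y h) - Y p (vf_app X h)) + X p d * Y p h).
  rewrite -[RHS]/((\sum_i N i p *: lie X (ham_vfield (f i)) p : tangent p) h
    + (\sum_i X p (N i) *: ham (f i) p : tangent p) h) !tangent_comb.
  have h1 : d p * X p (vf_app Y h) + Y p h * X p d =
    \sum_i (N i p * X p (bracket pi (f i) h) + ham (f i) p h * X p (N i)).
    rewrite -[LHS](tangent_leibniz (X p) d (vf_app Y h)) YE tangent_sum.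
    by apply: eq_bigr => i _; rewrite tangent_leibniz.
  have h2 : d p * Y p (vf_app X h) = \sum_i N i p * ham (f i) p (vf_app X h).
    by rewrite -tangent_comb -NE.
  rewrite mulrBr h2 addrAC [X p d * _]mulrC h1 -sumrB -big_split /=.
  apply: eq_bigr => i _.
  rewrite -[X in _ = _ * X + _]/(X p (vf_app (ham_vfield (f i)) h)
    - ham (f i) p (vf_app X h)) vf_app_ham.
  rewrite -[ham (f i) p (vf_app X h)]/(pi p (cdiff (f i) p) (cdiff _ p)).
  ring.
have alie : d p * a p (lie X Y p) + X p d * a p (Y p) =
    \sum_i (N i p * a p (lie X (ham_vfield (f i)) p) + X p (N i) * xi p (f i)).
  rewrite -!(ldualZ (a p)) -[LHS](ldualD (a p)) lieE [LHS]ldualD !ldual_sum.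
  by rewrite -big_split; apply: eq_bigr => i _; congr (_ + _ * _); exact: aP.
apply: (mulfI d0); rewrite mulr0 !mulrBr.
(* The derivative term [a(Y) X(d)] arises both from [X(d a(Y))] and from [a([X, d Y])], so adding it
   to both changes nothing. *)
have -> : d p * X p (potential_app Y) - d p * Y p aX - d p * a p (lie X Y p)
  = (d p * X p (potential_app Y) + a p (Y p) * X p d) - d p * Y p aX
    - (d p * a p (lie X Y p) + X p d * a p (Y p)) by ring.
rewrite XaY YaX alie -!sumrB big1 // => i _.
have := congr1 ( *%R (N i p)) (Xham (f i) p); rewrite mulr0 => h.
rewrite -[RHS]h; ring.
Qed.

Lemma lieN (X Y : vfield P) p : lie X Y p = - lie Y X p.
Proof.
apply/val_inj/funext => h.
by rewrite -[RHS]/(- (Y p (vf_app X h) - X p (vf_app Y h))) opprB.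
Qed.

(** For two Hamiltonian fields the identity is [L_xi pi = 0]. Tensoriality first frees the second
    argument, then, after exchanging the arguments by antisymmetry, the other one. *)
Lemma potential_closed : poisson_vfield_subspace P xi ->
  forall (X Y : leaf_vfield P) p,
  X p (potential_app Y) - Y p (potential_app X) - a p (lie X Y p) = 0.
Proof.
move=> xiP.
have ham_ham f g p :
    ham f p (vf_app xi g) - ham g p (vf_app xi f)
    - a p (lie (ham_vfield f) (ham_vfield g) p) = 0.
  rewrite -lie_ham -[ham_vfield _ p]/(ham (bracket pi f g) p).
  rewrite aP; have := xiP f g p; rewrite /lie_bivector.
  rewrite -[pi p (cdiff f p) _]/(ham f p (vf_app xi g)) biv_anti.
  rewrite -[pi p (cdiff g p) _]/(ham g p (vf_app xi f)); lra.
have ham_leaf f := @d_potential_tensorial (ham_vfield f) _ (ham_ham f).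
move=> X Y p; apply: d_potential_tensorial => g q.
have := ham_leaf g X q.
rewrite lieN.
have -> : a q (- lie X (ham_vfield g) q) = - a q (lie X (ham_vfield g) q).
  exact: (ldualN (a q)).
rewrite -[ham_vfield g q]/(ham g q); lra.
Qed.

Fact potential_form_proof p :
  linear_form_subspace (leaf_tangent p)
    (fun v : leaf_tangent p => a p (elt_val v)).
Proof. by move=> b u v; exact: (ldual_linear (a p)). Qed.

Definition potential_sect : sect (fun p : P => leaf_cotangent p) :=
  fun p => mk_elt (@potential_form_proof p).

Definition potential_form : leaf_form P :=
  mk_elt (leaf_potential_smooth : leaf_form_subspace P potential_sect).

End Closed.

Lemma leaf_poisson_vfield (xi : poisson_vfield P) :
  (forall p, leaf_subspace p (xi p)) ->
  exists alpha : closed_form P, sharp_form alpha = xi.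
Proof.
move=> /leaf_potential[a aP].
have cl : closed_form_subspace P (potential_form aP).
  move=> X Y Z ZE p; have := potential_closed aP (eltP xi) X Y p.
  rewrite -ZE.
  have appE V : leaf_form_app (potential_form aP) V = potential_app aP V.
    exact/val_inj.
  by rewrite !appE.
exists (mk_elt cl); apply/val_inj/val_inj/functional_extensionality_dep => p.
by apply/val_inj/funext => f; exact: aP.
Qed.

(** Tangency to the leaves depends only on the class, because Hamiltonian vector fields are
    tangent. *)
Lemma range_sharp_H1 (xi : poisson_vfield P) :
  range (@sharp_H1 R P) (qclass (hamiltonian_subspace P) xi) <->
  forall p, leaf_subspace p (xi p).
Proof.
split=> [[c _]|/leaf_poisson_vfield[alpha <-]]; last first.
  by exists (qclass (exact_form_subspace P) alpha) => //; rewrite sharp_H1E.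
rewrite -[c]qclassK sharp_H1E => /qclassE[f fE] p.
have -> : xi p = sharp_form (repr c) p - ham f p.
  by rewrite -fE -[X in _ - X]/(sharp_form (repr c) p - xi p) opprB addrC subrK.
apply: subspaceB; [exact: sharp_form_leaf|exact: ham_leaf].
Qed.

(** If [pi(alpha) = X_f], then [alpha(X_g) = X_f(g) = X_g(- f)]; the vectors [X_g] fill the leaf
    directions, so [alpha] is the leafwise differential of [- f]. *)
Lemma sharp_H1_inj : injective (@sharp_H1 R P).
Proof.
move=> x y xy; apply/eqP; rewrite -subr_eq0; apply/eqP.
have : sharp_H1 (x - y) = 0 by rewrite linearB /= xy subrr.
rewrite -[x - y]qclassK sharp_H1E.
rewrite -[RHS](linear0 (qclass (hamiltonian_subspace P))).
move=> /qclassE; rewrite subr0 => -[f fE].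
rewrite -(linear0 (qclass (exact_form_subspace P))); apply/qclassE.
rewrite subr0.
exists (- f) => p v; have [a vE] := eltP v; have [g gE] := cdiff_onto a.
have -> : v = leaf_ham g p by apply/val_inj; apply: etrans vE _; rewrite gE.
set alpha := repr _; rewrite -[LHS]/(sharp_form alpha p g) fE.
rewrite -[RHS]/(ham g p (- f)) -sub0r tangentB tangent0 sub0r.
exact: biv_anti.
Qed.

End LeafwisePotential.

(** * Transport of tangential classes by [E] *)

Theorem mainTheorem5 (R : realType) (P1 P2 : poisson_manifold R)
  (W : symplectic_manifold R) (rho1 : smap W P1) (rho2 : smap W P2)
  (E : {linear poisson_H1 P1 -> poisson_H1 P2}) :
  regular_poisson P1 -> regular_poisson P2 ->
  complete_full_dual_pair rho1 rho2 ->
  connected_simply_connected_fibers rho1 ->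
  connected_simply_connected_fibers rho2 ->
  ginzburg_lu_isomorphism rho1 rho2 E ->
  [set E c | c in range (@sharp_H1 R P1)] = range (@sharp_H1 R P2) /\
  exists Phi : {linear leaf_H1 P1 -> leaf_H1 P2}, bijective Phi.
Proof.
move=> reg1 reg2 [[sub1 surj1] [sub2 surj2] pois1 pois2 orth12 orth21 _ _] _ _.
move=> [bijE EP].
(* Surjectivity places every point of the base under some [w], where covectors are differentials of
   global functions. *)
have cdiff1 p (a : cotangent p) : exists g, a = @cdiff R P1 g p.
  by have [w wp] := surj1 p; move: a; rewrite -wp; exact: covector_cdiff.
have cdiff2 p (a : cotangent p) : exists g, a = @cdiff R P2 g p.
  by have [w wp] := surj2 p; move: a; rewrite -wp; exact: covector_cdiff.
have sp1 : scaled_poisson rho1 1 by move=> f g w; rewrite pois1 mul1r.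
have sp2 : scaled_poisson rho2 (-1) by move=> f g w; rewrite pois2 mulN1r.
have leafE (xi1 : poisson_vfield P1) (xi2 : poisson_vfield P2) :
    E (qclass (hamiltonian_subspace P1) xi1)
      = qclass (hamiltonian_subspace P2) xi2 ->
    (forall p, leaf_subspace p (xi1 p)) <-> (forall p, leaf_subspace p (xi2 p)).
  move=> /EP[F [F1 F2]]; split=> leaf p.
    have [w <-] := surj2 p.
    have := leaf_transfer (oner_neq0 R) sp1 sp2 sub1 sub2 orth12 orth21
      (u := symplectic_ham F w).
    by rewrite F1 F2 => /(_ (leaf _)) /(subspaceZ (-1)); rewrite scaleN1r opprK.
  have [w <-] := surj1 p.
  have := leaf_transfer _ sp2 sp1 sub2 sub1 orth21 orth12
    (u := symplectic_ham F w).
  rewrite F1 F2; apply; first by rewrite oppr_eq0 oner_eq0.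
  by rewrite -scaleN1r; apply: subspaceZ.
have rangeE c : range (@sharp_H1 R P1) c <-> range (@sharp_H1 R P2) (E c).
  rewrite -[c]qclassK -[E _]qclassK.
  apply: iff_trans (range_sharp_H1 cdiff1 reg1 _) _.
  apply: iff_trans _ (iff_sym (range_sharp_H1 cdiff2 reg2 _)).
  by apply: leafE; rewrite [RHS]qclassK.
have [E' EK E'K] := bijE.
split.
  apply/seteqP; split=> [_ [c /rangeE + <-]//|c c2].
  by exists (E' c); rewrite ?E'K //; apply/rangeE; rewrite E'K.
(* [Phi] is [E] read through the two injections; linearity and bijectivity follow from injectivity
   of [sharp_H1] on both sides. *)
have lift x : {y | sharp_H1 y = E (sharp_H1 x)}.
  apply: cid; have [|y _ yE] := (rangeE (sharp_H1 x)).1; first by exists x.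
  by exists y.
pose Phi x := sval (lift x).
have PhiE x : sharp_H1 (Phi x) = E (sharp_H1 x) by exact: (svalP (lift x)).
have inj1 := sharp_H1_inj cdiff1; have inj2 := sharp_H1_inj cdiff2.
have Phi_lin : linear Phi.
  by move=> b x y; apply: inj2; rewrite PhiE !linearP /= !PhiE.
have lift' y : {x | sharp_H1 y = E (sharp_H1 x)}.
  apply: cid; have [|x _ xE] := (rangeE (E' (sharp_H1 y))).2.
    by rewrite E'K; exists y.
  by exists x; rewrite xE E'K.
pose HPhi := GRing.isLinear.Build R (leaf_H1 P1) (leaf_H1 P2) *:%R Phi Phi_lin.
pose PhiL : {linear leaf_H1 P1 -> leaf_H1 P2} := HB.pack Phi HPhi.
exists PhiL; exists (fun y => sval (lift' y)) => x.
  apply: inj1; apply: (can_inj EK); rewrite -(svalP (lift' _)); exact: PhiE.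
by apply: inj2; rewrite PhiE -(svalP (lift' _)).
Qed.
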